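(* If $\pi$ is a decomposable permutation other than $12$, $213$ or $132$, then the permutation class $\mathrm{Av}(\pi)$ is splittable.
   Context: A permutation of order $n\ge 1$ is a sequence of the $n$ distinct numbers of $[n]=\{1,\dots,n\}$ (permutations are nonempty). A permutation $\pi$ contains a permutation $\sigma$ if $\pi$ has a subsequence order-isomorphic to $\sigma$; otherwise $\pi$ avoids $\sigma$. $\mathrm{Av}(\sigma)$ is the set of all $\sigma$-avoiding permutations. A permutation class is a set of permutations closed under taking contained permutations. The direct sum of $\sigma\in S_m$ and $\pi\in S_n$ is $\sigma\oplus\pi=\sigma(1),\dots,\sigma(m),\pi(1)+m,\dots,\pi(n)+m\in S_{m+n}$. A permutation is decomposable if it is a direct sum of two (nonempty) permutations. For permutation classes $P_1,\dots,P_m$, let $P_1\odot\dots\odot P_m$ be the set of all permutations whose entries can be colored by $m$ colors so that for each $i$ the subsequence of color $i$ is either empty or order-isomorphic to an element of $P_i$. A multiset $\{P_1,\dots,P_m\}$ of permutation classes is a splitting of a class $C$ if $C\subseteq P_1\odot\dots\odot P_m$; the $P_i$ are its parts. The splitting is nontrivial if no part is a superset of $C$. A class is splittable if it has a nontrivial splitting. *)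

(* Defs.v *)
From HB Require Import structures.
From mathcomp Require Import all_boot.
From mathcomp Require Import classical_sets.
Set Implicit Arguments.
Unset Strict Implicit.
Unset Printing Implicit Defensive.

Local Open Scope classical_set_scope.

(* One-line notation, with values 1, ..., n as on paper. *)
Definition is_permutation (s : seq nat) : bool :=
  (0 < size s) && perm_eq s (iota 1 (size s)).

Record permutation : Type := Permutation {
  pseq :> seq nat;
  permutationP : is_permutation pseq
}.

HB.instance Definition _ := [isSub for pseq].
HB.instance Definition _ := [Equality of permutation by <:].

Definition order_iso (s t : seq nat) : Prop :=
  size s = size t /\
  forall i j, i < size s -> j < size s ->
    (nth 0 s i < nth 0 s j) = (nth 0 t i < nth 0 t j).

Definition contains (pi sigma : permutation) : Prop :=
  exists s : seq nat, subseq s pi /\ order_iso s sigma.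

Definition avoids (pi sigma : permutation) : Prop := ~ contains pi sigma.

Definition Av (sigma : permutation) : set permutation :=
  [set pi | avoids pi sigma].

Definition permutation_class (C : set permutation) : Prop :=
  forall pi sigma : permutation, C pi -> contains pi sigma -> C sigma.

Lemma dsum_subproof (sigma pi : permutation) :
  is_permutation (sigma ++ [seq x + size sigma | x <- pi]).
Proof.
case: sigma pi => [s /andP[s0 sP]] [t /andP[_ tP]] /=.
rewrite /is_permutation size_cat size_map addn_gt0 s0 /= iotaD.
apply: perm_cat => //.
have -> : iota (1 + size s) (size t) = [seq x + size s | x <- iota 1 (size t)].
  by rewrite addnC iotaDl; apply: eq_map => x; rewrite addnC.
exact: perm_map.
Qed.

Definition dsum (sigma pi : permutation) : permutation :=
  Permutation (dsum_subproof sigma pi).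

Definition decomposable (pi : permutation) : Prop :=
  exists sigma tau : permutation, pi = dsum sigma tau.

(* The entries of a permutation are distinct, so a coloring of its entries is
   a coloring of their values; colors of other natural numbers are irrelevant. *)
Definition odot (m : nat) (P : 'I_m -> set permutation) : set permutation :=
  [set pi | exists c : nat -> 'I_m, forall i : 'I_m,
     let s := [seq x <- pi | c x == i] in
     s = [::] \/ exists2 sigma : permutation, P i sigma & order_iso s sigma].

Definition splitting (m : nat) (P : 'I_m -> set permutation)
    (C : set permutation) : Prop :=
  (forall i, permutation_class (P i)) /\ C `<=` odot P.

Definition nontrivial_splitting (m : nat) (P : 'I_m -> set permutation)
    (C : set permutation) : Prop :=
  splitting P C /\ forall i, ~ (C `<=` P i).

Definition splittable (C : set permutation) : Prop :=
  exists (m : nat) (P : 'I_m -> set permutation),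
    0 < m /\ nontrivial_splitting P C.

Lemma contains_trans (pi tau sigma : permutation) :
  contains pi tau -> contains tau sigma -> contains pi sigma.
Proof.
move=> [t [t_pi [sz_t iso_t]]] [s [/subseqP[m sz_m ->] [sz_s iso_s]]].
set I := mask m (iota 0 (size tau)).
have maskE (u : seq nat) : size u = size tau ->
    mask m u = [seq nth 0 u k | k <- I].
  by move=> szu; rewrite /I map_mask -szu map_nth_iota0 // take_size.
have I_lt i : i < size I -> nth 0 I i < size tau.
  move=> /(mem_nth 0) /mem_mask; by rewrite mem_iota.
move: sz_s iso_s; rewrite (maskE tau) // size_map => sz_s iso_s.
exists (mask m t); split; first exact: subseq_trans (mask_subseq _ _) t_pi.
rewrite (maskE t) //; split; first by rewrite size_map.
rewrite size_map => i j hi hj; rewrite -iso_s // !(nth_map 0) //.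
by rewrite iso_t // sz_t; apply: I_lt.
Qed.

Lemma Av_permutation_class (sigma : permutation) : permutation_class (Av sigma).
Proof.
by move=> pi tau av_pi pi_tau tau_sigma; apply/av_pi/contains_trans/tau_sigma.
Qed.

(* Main.v *)
(* Let Av(pi) be given by pi = sigma (+) tau.  Reading a permutation from left to
   right and colouring greedily splits Av(a (+) b (+) c) into Av(a (+) b) and
   Av(b (+) c); applied to sigma (+) 1 (+) tau, or to a finer decomposition of pi,
   this settles everything except 1 (+) S and, by reverse-complement, S (+) 1,
   with S indecomposable of size at least 3.

   For 1 (+) S, join two points of T in Av(1 (+) S) when they form an inversion and
   have a common point below and to the left of both, and let d be the distance in
   this graph to the highest point of the component.  If u and v lie in the same
   layer of the same component, u is to the left of v, and J is a neighbour of u in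
   the previous layer lying to its left, then J is above v: otherwise J is below and
   to the left of v, and so is the whole geodesic from J to the highest point, as
   no point on it is adjacent to v.  There is a configuration X, avoiding
   1 (+) S, with two points u and v connected inside X, such that any X in T
   together with such a J contains 1 (+) S, the point J playing the top of S.  So X
   does not embed in any class of points with the same parity of d whose
   predecessor is on the left.  Exchanging positions and values handles predecessors
   on the right, and the points with d = 0 avoid 132: five colours suffice. *)

Require Import Defs.
From mathcomp Require Import all_boot.
From mathcomp Require Import boolp classical_sets.
From mathcomp Require Import zify.

Set Implicit Arguments.
Unset Strict Implicit.
Unset Printing Implicit Defensive.

(** * Point configurations in the plane and their embeddings *)

Definition dot : Type := (nat * nat)%type.

Definition ll (p q : dot) : bool := (p.1 < q.1) && (p.2 < q.2).
Notation "p \<< q" := (ll p q) (at level 70).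

(** A configuration stands for its set of points: order and repetitions in the list carry no
    meaning. *)
Definition config : Type := seq dot.

Definition generic (T : config) : Prop :=
  (forall p q : dot, p \in T -> q \in T -> p.1 = q.1 -> p = q) /\
  (forall p q : dot, p \in T -> q \in T -> p.2 = q.2 -> p = q).

Definition emb (S T : config) (f : dot -> dot) : Prop :=
  (forall p : dot, p \in S -> f p \in T) /\
  (forall p q : dot, p \in S -> q \in S -> ((f p).1 < (f q).1) = (p.1 < q.1) /\
                       ((f p).2 < (f q).2) = (p.2 < q.2)).

(** Embeddings up to a half-turn, the geometric form of the reverse-complement. *)
Definition anti_emb (S T : config) (f : dot -> dot) : Prop :=
  (forall p : dot, p \in S -> f p \in T) /\
  (forall p q : dot, p \in S -> q \in S -> ((f p).1 < (f q).1) = (q.1 < p.1) /\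
                       ((f p).2 < (f q).2) = (q.2 < p.2)).

(** Reflection in the diagonal, which turns a permutation into its inverse. *)
Definition swap (p : dot) : dot := (p.2, p.1).

Definition graph (s : seq nat) : config :=
  [seq (i, nth 0 s i) | i <- iota 0 (size s)].

Lemma mem_graph s (p : dot) : (p \in graph s) = (p.1 < size s) && (p.2 == nth 0 s p.1).
Proof.
apply/mapP/andP => [[i]|[hp /eqP e]].
  by rewrite mem_iota /= add0n => hi ->.
by exists p.1; rewrite ?mem_iota ?add0n // -e; case: p {hp e}.
Qed.

Lemma generic_graph s : uniq s -> generic (graph s).
Proof.
move=> us; split=> -[a b] [c d]; rewrite !mem_graph /=.
  by move=> /andP[_ /eqP->] /andP[_ /eqP->] ->.
move=> /andP[ha /eqP->] /andP[hc /eqP->] e.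
by have -> : a = c by apply/eqP; rewrite -(nth_uniq 0 ha hc us) e.
Qed.

Lemma emb_comp S T U f g : emb S T f -> emb T U g -> emb S U (g \o f).
Proof.
move=> [f1 f2] [g1 g2]; split=> [p pS|p q pS qS] /=; first exact/g1/f1.
have [<- <-] := f2 _ _ pS qS; exact: (g2 _ _ (f1 _ pS) (f1 _ qS)).
Qed.

Lemma anti_comp S T U f g :
  anti_emb S T f -> anti_emb T U g -> emb S U (g \o f).
Proof.
move=> [f1 f2] [g1 g2]; split=> [p pS|p q pS qS] /=; first exact/g1/f1.
have [<- <-] := f2 _ _ qS pS; exact: (g2 _ _ (f1 _ pS) (f1 _ qS)).
Qed.

Lemma anti_emb_comp S T U f g :
  anti_emb S T f -> emb T U g -> anti_emb S U (g \o f).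
Proof.
move=> [f1 f2] [g1 g2]; split=> [p pS|p q pS qS] /=; first exact/g1/f1.
have [<- <-] := f2 _ _ pS qS; exact: (g2 _ _ (f1 _ pS) (f1 _ qS)).
Qed.

Lemma emb_sub S S' T T' f : {subset S' <= S} -> {subset T <= T'} ->
  emb S T f -> emb S' T' f.
Proof.
move=> sS sT [f1 f2]; split=> [p /sS/f1/sT //|p q /sS pS /sS qS]; exact: f2.
Qed.

Lemma emb_ll S T f (p q : dot) : emb S T f -> p \in S -> q \in S ->
  (f p \<< f q) = (p \<< q).
Proof. by move=> [_ f2] pS qS; rewrite /ll; case: (f2 _ _ pS qS) => -> ->. Qed.

Lemma emb_inj S T f : generic S -> emb S T f -> forall p q : dot, p \in S -> q \in S -> f p = f q -> p = q.
Proof.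
move=> [g1 _] [_ f2] p q pS qS e; apply: g1 => //.
have [a _] := f2 _ _ pS qS; have [b _] := f2 _ _ qS pS.
by move: a b; rewrite e; lia.
Qed.

(** Distinct points of a generic source differ in both coordinates, so preserving strict
    inequalities already implies reflecting them. *)
Lemma embI S T f : generic S -> (forall p : dot, p \in S -> f p \in T) ->
  (forall p q : dot, p \in S -> q \in S -> p.1 < q.1 -> (f p).1 < (f q).1) ->
  (forall p q : dot, p \in S -> q \in S -> p.2 < q.2 -> (f p).2 < (f q).2) -> emb S T f.
Proof.
move=> [g1 g2] fS m1 m2; split=> // p q pS qS.
have [<-|npq] := eqVneq p q; first by split; lia.
have n1 : p.1 <> q.1 by move/(g1 _ _ pS qS)/eqP; rewrite (negPf npq).
have n2 : p.2 <> q.2 by move/(g2 _ _ pS qS)/eqP; rewrite (negPf npq).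
have := m1 _ _ pS qS; have := m1 _ _ qS pS.
have := m2 _ _ pS qS; have := m2 _ _ qS pS.
by move=> *; split; lia.
Qed.

Lemma generic_neq T (p q : dot) : generic T -> p \in T -> q \in T -> p != q ->
  p.1 <> q.1 /\ p.2 <> q.2.
Proof.
by move=> [g1 g2] pT qT /eqP npq; split=> /[dup] e; [move/g1|move/g2]; auto.
Qed.

Lemma mem_swap T (p : dot) : (p \in map swap T) = (swap p \in T).
Proof.
have sK : involutive swap by case.
by rewrite -{1}(sK p) (mem_map (inv_inj sK)).
Qed.

Lemma generic_swap T : generic T -> generic (map swap T).
Proof.
move=> [g1 g2]; split=> -[a b] [c d]; rewrite !mem_swap /swap /= => pT qT e.
  by case: (g2 _ _ pT qT e) => -> ->.
by case: (g1 _ _ pT qT e) => -> ->.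
Qed.

Lemma emb_swap S T f : emb S T f ->
  emb (map swap S) (map swap T) (swap \o f \o swap).
Proof.
move=> [f1 f2]; split=> [p|p q].
  by rewrite !mem_swap /= => /f1; rewrite /swap /=; case: (f _).
rewrite !mem_swap => pS qS; have [e1 e2] := f2 _ _ pS qS.
by rewrite /= e1 e2.
Qed.

Lemma swapK_map T : map swap (map swap T) = T.
Proof. by rewrite -map_comp map_id_in // => -[]. Qed.

Definition emb_into S T : Prop := exists f, emb S T f.

Lemma exists_min (T : config) (k : dot -> nat) : T <> [::] ->
  exists2 p : dot, p \in T & (forall q : dot, q \in T -> k p <= k q).
Proof.
elim: T => // a [|b T] IH _.
  by exists a => [|q]; rewrite inE ?eqxx // => /eqP->.
have [p pT pm] : exists2 p : dot, p \in b :: T &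
    forall q : dot, q \in b :: T -> k p <= k q by exact: IH.
have [le|lt] := leqP (k a) (k p).
  exists a; rewrite ?mem_head // => q; rewrite inE => /orP[/eqP->//|/pm]; lia.
exists p; first by rewrite (mem_behead (s := a :: b :: T)).
move=> q; rewrite inE => /orP[/eqP->|/pm //]; lia.
Qed.

Lemma exists_bound (T : config) (k : dot -> nat) :
  exists B, (forall p : dot, p \in T -> k p <= B).
Proof.
exists (\max_(p <- T) k p) => p pT; exact: leq_bigmax_seq.
Qed.

Lemma exists_max (T : config) (k : dot -> nat) : T <> [::] ->
  exists2 p : dot, p \in T & (forall q : dot, q \in T -> k q <= k p).
Proof.
move=> T0; have [B kB] := exists_bound T k.
have [p pT pm] := exists_min (fun p => B - k p) T0.
by exists p => // q qT; have := pm _ qT; have := kB _ qT; have := kB _ pT; lia.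
Qed.

(* An increasing self-map of a finite chain is the identity; [r] is its graph. *)
Lemma increasing_selfmap_id (S : config) (r : dot -> dot -> Prop) :
  generic S ->
  (forall p : dot, p \in S -> exists2 q : dot, q \in S & r p q) ->
  (forall p p' q q' : dot, p \in S -> p' \in S -> q \in S -> q' \in S ->
     r p q -> r p' q' -> p.1 < p'.1 -> q.1 < q'.1) ->
  (forall p : dot, p \in S -> r p p).
Proof.
move=> [g1 _] tot mono.
(* If [p] were related to some [q] on its left, monotonicity would send [q] further left still;
   induction on the column excludes this. [le] is the mirror image, with columns counted down from
   [B]. *)
have ge n : forall p q : dot, p \in S -> q \in S -> r p q -> p.1 <= n -> p.1 <= q.1.
  elim: n => [|n IH] p q pS qS rpq pn; first lia.
  case: leqP => // lt; have [q' q'S rq] := tot _ qS.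
  have := mono _ _ _ _ qS pS q'S qS rq rpq lt; have := IH _ _ qS q'S rq; lia.
have [B SB] := exists_bound S (@fst nat nat).
have le n : forall p q : dot, p \in S -> q \in S -> r p q -> B - p.1 <= n -> q.1 <= p.1.
  elim: n => [|n IH] p q pS qS rpq pn; have Bp := SB _ pS; have Bq := SB _ qS; first lia.
  case: (leqP q.1 p.1) => // lt; have [q' q'S rq] := tot _ qS.
  have := mono _ _ _ _ pS qS qS q'S rpq rq lt; have := IH _ _ qS q'S rq; lia.
move=> p pS; have [q qS rpq] := tot _ pS.
have e : p = q.
  apply: g1 => //; have := ge _ _ _ pS qS rpq (leqnn _).
  by have := le _ _ _ pS qS rpq (leqnn _); lia.
by rewrite {2}e.
Qed.

(** * Indecomposable patterns, the inversion graph and the notion of obstruction *)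

(** [D] plays the first summand of a direct sum decomposition. *)
Definition indecomposable (S : config) : Prop :=
  forall D : pred dot,
    (forall p q : dot, p \in S -> q \in S -> D p -> ~~ D q -> p \<< q) ->
    (forall p : dot, p \in S -> D p) \/ (forall p : dot, p \in S -> ~~ D p).

(** The main tool for avoidance: a copy of [S] cannot be spread over two sets, one entirely below
    and to the left of the other. *)
Lemma indec_emb_split S T f (A : pred dot) : indecomposable S ->
  emb S T f ->
  (forall p q : dot, p \in S -> q \in S -> A (f p) -> ~~ A (f q) ->
     f p \<< f q) ->
  (forall p : dot, p \in S -> A (f p)) \/ (forall p : dot, p \in S -> ~~ A (f p)).
Proof.
move=> iS ef sep; apply: (iS (fun p => A (f p))) => p q pS qS Ap nAq.
by rewrite -(emb_ll ef pS qS); apply: sep.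
Qed.

Definition contains_one_plus (S T : config) : Prop :=
  exists2 o : dot, o \in T & exists2 f, emb S T f & (forall p : dot, p \in S -> o \<< f p).

Lemma contains_one_plus_swap S T : contains_one_plus S T ->
  contains_one_plus (map swap S) (map swap T).
Proof.
move=> [o oT [f ef of_]]; exists (swap o); first by rewrite mem_swap; case: o oT {of_}.
exists (swap \o f \o swap); first exact: emb_swap.
by move=> p; rewrite mem_swap => /of_; rewrite /ll /= andbC.
Qed.

(** In either order, [p] and [q] play the 3 and the 2 of a copy of 132. *)
Definition adjacent (T : config) (p q : dot) : Prop :=
  [/\ p \in T, q \in T,
      (p.1 < q.1) && (q.2 < p.2) || (q.1 < p.1) && (p.2 < q.2) &
      exists2 c : dot, c \in T & (c \<< p) && (c \<< q)].

Inductive connected (T : config) : dot -> dot -> Prop :=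
| connected_refl p : connected T p p
| connected_step p q r : adjacent T p q -> connected T q r -> connected T p r.

(* In the application J is a neighbour of [f u], on its left, with common lower-left
   point [c], in a layer closer to the root. *)
Definition left_obstruction (S X : config) : Prop :=
  [/\ generic X, ~ contains_one_plus S X &
   exists u v : dot, [/\ u \in X, v \in X, u.1 < v.1, connected X u v &
    forall T f, emb X T f ->
    forall c J : dot, c \in T -> J \in T -> c \<< J -> c \<< f u ->
      J.1 < (f u).1 -> (f v).2 < J.2 -> contains_one_plus S T]].

(** At least three points, in the form in which this is used. *)
Definition large (S : config) : Prop :=
  forall a b : dot, exists c : dot, [/\ c \in S, c != a & c != b].

(** The context is cleared, so that [lia] sees only the facts that were moved into the goal. *)
Ltac arith := clear; rewrite /ll /=; intros; first [lia | exfalso; lia].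

(** * Construction of the obstructions *)

Section Obstruction.
Variables (S : config) (M : nat) (t l f0 : dot).
Hypotheses (gS : generic S) (iS : indecomposable S) (lS : large S).
Hypothesis S1 : forall p : dot, p \in S -> p.1 <= M.
Hypothesis S2 : forall p : dot, p \in S -> p.2 <= M.
Hypotheses (tS : t \in S) (lowS : l \in S) (fS : f0 \in S).
Hypothesis t_max : forall p : dot, p \in S -> p.2 <= t.2.
Hypothesis l_min : forall p : dot, p \in S -> l.2 <= p.2.
Hypothesis f_min : forall p : dot, p \in S -> f0.1 <= p.1.

(** A point both first and lowest would split off as a summand 1. *)
Lemma first_neq_lowest : f0 <> l.
Proof.
move=> e; have [c [cS cf _]] := lS f0 f0.
have [] := iS (D := fun p => p == f0).
- move=> p q _ qS /eqP-> nq; have [] := generic_neq gS qS fS nq.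
  have := f_min qS; have := l_min qS; rewrite /ll -e; lia.
- by move=> /(_ c cS); rewrite (negPf cf).
- by move=> /(_ f0 fS); rewrite eqxx.
Qed.

Lemma lowest_neq_top : l <> t.
Proof.
move=> e; have [c [cS cl _]] := lS l l.
have [_] := generic_neq gS cS lowS cl.
have := t_max cS; have := l_min cS; rewrite e; lia.
Qed.

Section TopNotFirst.
Hypothesis ft : f0 <> t.

(** As [M] bounds both coordinates of [S], the offsets put the pieces into disjoint bands. The
    factor 3 in [F] frees two columns before each of its points; those before [F l] receive [m] and
    [Z]. *)
Let Y (p : dot) : dot :=
  (if p.1 < t.1 then p.1 + 2 else p.1 + 4 * M + 10, p.2 + M + 4).
Let F (p : dot) : dot := (t.1 + 3 * p.1 + 4, p.2 + 1).
Let G : dot := (0, M + 2).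
Let W : dot := (1, 2 * M + 8).
Let m : dot := (t.1 + 3 * l.1 + 2, 0).
Let Z : dot := (t.1 + 3 * l.1 + 3, M + 3).
Let E : dot := (6 * M + 20, 2 * M + 6).

(* [Y] draws S without its top, and [F] a whole copy of S in the horizontal slot of
   the top.  From left to right: G, W, the part of Y before the slot, F with m and Z
   inserted just before its lowest point, the rest of Y, E.  From bottom to top:
   m, F, G, Z, Y, E, W.  In a configuration avoiding 1 (+) S, a point below and to
   the left of the lowest point of F lies to the right of the first point of F;
   hence so does any J above and to the right of it, and if J is above E and to the
   left of the lowest point of F, then G, Y and J form 1 (+) S. *)
Definition obstruction1 : config :=
  [:: G; W; m; Z; E] ++ map Y [seq p <- S | p != t] ++ map F S.

(** Membership as an inductive predicate, so that case analysis replaces a point by its explicit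
    formula. *)
Inductive in_obstruction1 : dot -> Prop :=
| in1G : in_obstruction1 G | in1W : in_obstruction1 W
| in1m : in_obstruction1 m | in1Z : in_obstruction1 Z
| in1E : in_obstruction1 E
| in1Y (p : dot) : p \in S -> p != t -> in_obstruction1 (Y p)
| in1F (p : dot) : p \in S -> in_obstruction1 (F p).

Lemma obstruction1P (p : dot) : p \in obstruction1 <-> in_obstruction1 p.
Proof.
split.
  rewrite !mem_cat !inE -!orbA.
  case/or4P=> [/eqP->|/eqP->|/eqP->|]; try by constructor.
  case/or4P=> [/eqP->|/eqP->|/mapP[q]|/mapP[q qS ->]]; try by constructor.
  by rewrite mem_filter => /andP[qt qS] ->; constructor.
case=> [|||||q qS qt|q qS]; rewrite !mem_cat !inE ?eqxx ?orbT //.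
  by rewrite map_f ?orbT // mem_filter qt.
by rewrite map_f ?orbT.
Qed.

Lemma Y1 (p : dot) : p \in S -> p != t ->
  p.1 < t.1 /\ (Y p).1 = p.1 + 2 \/ t.1 < p.1 /\ (Y p).1 = p.1 + 4 * M + 10.
Proof.
move=> pS pt; rewrite /Y /=; have [n1 _] := generic_neq gS pS tS pt.
by case: ltnP => ?; [left|right]; split; lia.
Qed.

Lemma generic_obstruction1 : generic obstruction1.
Proof.
have lM := S1 lowS; have tM := S1 tS.
have [g1 g2] := gS.
split=> p q /obstruction1P hp /obstruction1P hq.
  case: hp => [|||||p' pS pt|p' pS]; case: hq => [|||||q' qS qt|q' qS] //;
  move: lM tM; try (move: (S1 pS)); try (move: (Y1 pS pt));
  try (move: (S1 qS)); try (move: (Y1 qS qt)); try (arith).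
    by move=> *; have -> : p' = q' by apply: g1 => //; lia.
  by rewrite /= => *; have -> : p' = q' by apply: g1 => //; lia.
case: hp => [|||||p' pS pt|p' pS]; case: hq => [|||||q' qS qt|q' qS] //;
  move: lM tM; try (move: (S2 pS)); try (move: (S2 qS));
  try (arith).
  by rewrite /= => *; have -> : p' = q' by apply: g2 => //; lia.
by rewrite /= => *; have -> : p' = q' by apply: g2 => //; lia.
Qed.

Lemma top_of_obstruction1 (p : dot) : p \in obstruction1 -> p.2 <= 2 * M + 8.
Proof.
by move=> /obstruction1P[|||||q qS _|q qS]; try (move: (S2 qS)); arith.
Qed.

Lemma emb_not_constant T f (e : dot) : emb S T f ->
  (forall p : dot, p \in S -> f p = e) -> False.
Proof.
move=> ef fe; have [c [cS /eqP ct _]] := lS t t; apply: ct.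
by apply: (emb_inj gS ef) => //; rewrite !fe.
Qed.

Lemma no_emb_Y_E f : emb S obstruction1 f ->
  (forall p : dot, p \in S ->
     f p = E \/ exists2 q : dot, q \in S & q != t /\ f p = Y q) -> False.
Proof.
move=> ef im.
have := indec_emb_split (A := fun p => p != E) iS ef.
case=> [p q pS qS nE /negPn/eqP-> | nE | all_E].
- have [/eqP|[p' p'S [pt ->]]] := im p pS; first by rewrite (negPf nE).
  move: (Y1 p'S pt) (S1 p'S) (S2 p'S) (S1 tS); arith.
- have [] : t != t /\ f t = Y t; last by rewrite eqxx.
  apply: (increasing_selfmap_id gS (r := fun p q => q != t /\ f p = Y q)) => //.
    move=> p pS; have [/eqP|[q qS h]] := im p pS; first by rewrite (negPf (nE _ pS)).
    by exists q.
  move=> p p' q q' pS p'S qS q'S [qt e] [q't e'].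
  have [<- _] := (proj2 ef) _ _ pS p'S; rewrite e e'.
  move: (Y1 qS qt) (Y1 q'S q't) (S1 qS) (S1 q'S); arith.
- by apply: (emb_not_constant ef (e := E)) => p /all_E /negPn/eqP.
Qed.

(** Case analysis on the point [o] playing the 1. Nothing fits above and to the right of [W] or [E],
    while [Z] and the points of [Y] leave only [Y] and [E], where [no_emb_Y_E] applies. The cases
    [G], [m] and [F] need more work. *)
Lemma obstruction1_avoids : ~ contains_one_plus S obstruction1.
Proof.
have lM := S1 lowS; have tM := S1 tS.
move=> [o /obstruction1P oX [f ef fo]].
have fX p : p \in S -> in_obstruction1 (f p).
  by move=> pS; apply/obstruction1P/(proj1 ef).
case: oX fo => [|||||o' oS ot|o' oS] fo.
(* Case [G]. The point [W] is the leftmost available and the highest of all, so its preimage would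
   be both [f0] and [t]. *)
- have im p : p \in S -> [\/ f p = W, f p = Z, f p = E |
      exists2 q : dot, q \in S & q != t /\ f p = Y q].
    move=> pS; have := fo p pS; case: (fX p pS) => [|||||q qS qt|q qS];
      try (by constructor); try (arith).
      by move=> _; apply: Or44; exists q.
    by move: (S2 qS); arith.
  have nW p : p \in S -> f p <> W.
    move=> pS e; have [pf|pf] := eqVneq p f0.
      move: (proj2 ((proj2 ef) _ _ pS tS)) (generic_neq gS fS tS (introN eqP ft)).
      move: (top_of_obstruction1 (proj1 ef _ tS)) (t_max pS).
      rewrite pf -pf e pf; arith.
    move: (proj1 ((proj2 ef) _ _ fS pS)) (generic_neq gS pS fS pf).
    move: (f_min pS) (fo _ fS); rewrite e; arith.
  have := indec_emb_split (A := fun p => p != E) iS ef.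
  case=> [p q pS qS nE /negPn/eqP-> | nE | all_E].
  + have [/nW|->|/eqP|[p' p'S [pt ->]]] := im p pS => //.
    * by move: lM tM; arith.
    * by rewrite (negPf nE).
    by move: (Y1 p'S pt) (S1 p'S) (S2 p'S) lM tM; arith.
  (* [Z] occupies the column slot of [t], so reading [Z] as [t] gives an increasing self-map of [S].
     It forces [f t = Z], but [Z] is below [Y] and cannot be the top. *)
  + pose r (p q : dot) := q = t /\ f p = Z \/ q != t /\ f p = Y q.
    have [] : r t t.
    * apply: (increasing_selfmap_id gS (r := r)) => //.
        move=> p pS; have [/nW|e|/eqP|[q qS h]] := im p pS => //.
        - by exists t => //; left.
        - by rewrite (negPf (nE _ pS)).
        by exists q => //; right.
      move=> p p' q q' pS p'S qS q'S h h'.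
      have [<- _] := (proj2 ef) _ _ pS p'S.
      move: (S1 qS) (S1 q'S) lM tM.
      case: h h' => [[-> ->]|[qt ->]] [[-> ->]|[q't ->]]; try by arith.
      * by move: (Y1 q'S q't); arith.
      * by move: (Y1 qS qt); arith.
      by move: (Y1 qS qt) (Y1 q'S q't); arith.
    * move=> [_ ft_]; have [c [cS ct _]] := lS t t.
      move: (proj2 ((proj2 ef) _ _ cS tS)) (generic_neq gS cS tS ct) (t_max cS).
      by rewrite ft_; have [/nW|->|->|[q qS [qt ->]]] := im c cS => //; arith.
    by rewrite eqxx => -[].
  + by apply: (emb_not_constant ef (e := E)) => p /all_E /negPn/eqP.
- by move: (fo _ tS) (top_of_obstruction1 (proj1 ef _ tS)); arith.
(* Case [m]. The copy lies wholly in [F] with [Z], or wholly in [Y] with [E]. In the former case [Z]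
   would be both first and top, so the copy is inside [F] from the column of [l] on; being the
   identity, it makes [l] the first point. *)
- have im p : p \in S -> [\/ f p = Z, f p = E,
      exists2 q : dot, q \in S & [/\ q != t, t.1 < q.1 & f p = Y q] |
      exists2 q : dot, q \in S & l.1 <= q.1 /\ f p = F q].
    move=> pS; have := fo p pS; case: (fX p pS) => [|||||q qS qt|q qS];
      try (by constructor); try (arith).
      move=> h; apply: Or43; exists q => //; split=> //.
      by move: h (Y1 qS qt); arith.
    by move=> h; apply: Or44; exists q => //; split=> //; move: h; arith.
  pose A (p : dot) := (p.2 < M + 4).
  have ZA : A Z by rewrite /A; arith.
  have FA q : q \in S -> A (F q) by move=> /S2; rewrite /A; arith.
  have nYA q : ~~ A (Y q) by rewrite /A; arith.
  have nEA : ~~ A E by rewrite /A; arith.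
  have := indec_emb_split (A := A) iS ef.
  case=> [p q pS qS Ap nAq | low | high].
  + have {Ap} hp : (f p).1 <= t.1 + 3 * M + 4 /\ (f p).2 <= M + 3.
      case: (im p pS) Ap => [->|->|[p' _ [_ _ ->]]|[p' p'S [_ ->]]].
      * by move: lM; arith.
      * by rewrite (negPf nEA).
      * by rewrite (negPf (nYA _)).
      by move: (S1 p'S) (S2 p'S); arith.
    case: (im q qS) nAq => [->|->|[q' q'S [qt lt ->]]|[q' q'S [lq ->]]].
    * by rewrite ZA.
    * by move: hp tM; arith.
    * by move: hp lt (Y1 q'S qt); arith.
    * by rewrite FA.
  + have im' p : p \in S -> f p = Z \/
        exists2 q : dot, q \in S & l.1 <= q.1 /\ f p = F q.
      move=> pS; case: (im p pS) (low _ pS) => [->|->|[q qS [_ _ ->]]|h].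
      * by left.
      * by rewrite (negPf nEA).
      * by rewrite (negPf (nYA _)).
      by right.
    have nZ p : p \in S -> f p <> Z.
      move=> pS e; have [pf|pf] := eqVneq p f0.
        move: (proj2 ((proj2 ef) _ _ pS tS)) (generic_neq gS fS tS (introN eqP ft)).
        move: (t_max pS); rewrite e pf.
        have [->|[q qS [_ ->]]] := im' t tS; first by arith.
        by move: (S2 qS); arith.
      move: (proj1 ((proj2 ef) _ _ fS pS)) (generic_neq gS pS fS pf) (f_min pS).
      rewrite e; have [->|[q qS [lq ->]]] := im' f0 fS; first by arith.
      by move: lq; arith.
    have [lq _] : l.1 <= f0.1 /\ f f0 = F f0.
      apply: (increasing_selfmap_id gS
                (r := fun p q => l.1 <= q.1 /\ f p = F q)) => //.
        by move=> p pS; have [/nZ|] := im' p pS.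
      move=> p p' q q' pS p'S qS q'S [_ e] [_ e'].
      by have [<- _] := (proj2 ef) _ _ pS p'S; rewrite e e'; arith.
    apply: first_neq_lowest; apply: (proj1 gS) => //.
    by move: lq (f_min lowS); arith.
  + apply: (no_emb_Y_E ef) => p pS.
    case: (im p pS) (high _ pS) => [->|->|[q' q'S [qt _ ->]]|[q' q'S [lq ->]]].
    * by rewrite ZA.
    * by left.
    * by right; exists q'.
    * by rewrite FA.
- apply: (no_emb_Y_E ef) => p pS; have := fo p pS.
  case: (fX p pS) => [|||||q qS qt|q qS]; try by (move=> h; exfalso; move: h; arith).
  + by left.
  + by right; exists q.
  by move: (S2 qS) => s2 h; exfalso; move: s2 h; arith.
- move: (fo _ tS); case: (fX t tS) => [|||||q qS qt|q qS]; try by arith.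
    by move: (S1 qS) (Y1 qS qt) tM; arith.
  by move: (S1 qS) tM; arith.
- apply: (no_emb_Y_E ef) => p pS; have := fo p pS; have := S2 oS.
  case: (fX p pS) => [|||||q qS qt|q qS];
    try by (move=> s2 h; exfalso; move: s2 h (Y1 oS ot) (S1 oS) lM tM; arith).
  + by left.
  + by right; exists q.
  by move=> s2 h; exfalso; move: h (S2 qS) ; arith.
- have im p : p \in S -> [\/ f p = Z /\ o'.1 < l.1, f p = E,
      exists2 q : dot, q \in S & [/\ q != t, t.1 < q.1 & f p = Y q] |
      exists2 q : dot, q \in S & o' \<< q /\ f p = F q].
    move=> pS; have := fo p pS; case: (fX p pS) => [|||||q qS qt|q qS];
      try (by constructor); try by arith.
    + by move=> h; apply: Or41; split=> //; move: h; arith.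
    + move=> h; apply: Or43; exists q => //; split=> //.
      by move: h (Y1 qS qt); arith.
    by move=> h; apply: Or44; exists q => //; split=> //; move: h; arith.
  pose A (p : dot) := (p.2 < M + 4).
  have ZA : A Z by rewrite /A; arith.
  have FA q : q \in S -> A (F q) by move=> /S2; rewrite /A; arith.
  have nYA q : ~~ A (Y q) by rewrite /A; arith.
  have nEA : ~~ A E by rewrite /A; arith.
  have := indec_emb_split (A := A) iS ef.
  case=> [p q pS qS Ap nAq | low | high].
  + have {Ap} hp : (f p).1 <= t.1 + 3 * M + 4 /\ (f p).2 <= M + 3.
      case: (im p pS) Ap => [[-> _]|->|[p' _ [_ _ ->]]|[p' p'S [_ ->]]].
      * by move: lM; arith.
      * by rewrite (negPf nEA).
      * by rewrite (negPf (nYA _)).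
      by move: (S1 p'S) (S2 p'S); arith.
    case: (im q qS) nAq => [[-> _]|->|[q' q'S [qt lt ->]]|[q' q'S [lq ->]]].
    * by rewrite ZA.
    * by move: hp tM; arith.
    * by move: hp lt (Y1 q'S qt); arith.
    * by rewrite FA.
  (* Case [F o'], low copy. [Z] stands just before [F l], and [F l] itself is not above [F o'], so
     [Z] may be read as [l]. The resulting self-map would fix [o'], which is not in its range. *)
  + pose r (p q : dot) := [/\ f p = Z, o'.1 < l.1 & q = l] \/
                          (o' \<< q /\ f p = F q).
    have : r o' o'.
      apply: (increasing_selfmap_id gS (r := r)) => //.
        move=> p pS; case: (im p pS) (low _ pS) => [[e lt]|->|[q qS [_ _ ->]]|[q qS h]].
        * by exists l => //; left.
        * by rewrite (negPf nEA).
        * by rewrite (negPf (nYA _)).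
        by exists q => //; right.
      move=> p p' q q' pS p'S qS q'S h h'.
      have [<- _] := (proj2 ef) _ _ pS p'S.
      case: h h' => [[-> _ ->]|[oq ->]] [[-> _ ->]|[oq' ->]]; try by arith.
      * have nl : q' != l by apply/eqP=> e; move: (l_min oS) oq'; rewrite e; arith.
        by move: (generic_neq gS q'S lowS nl); arith.
    by case=> [[_ h e]|[h _]]; [rewrite e in h|]; move: h; arith.
  + apply: (no_emb_Y_E ef) => p pS.
    case: (im p pS) (high _ pS) => [[-> _]|->|[q' q'S [qt _ ->]]|[q' q'S [lq ->]]].
    * by rewrite ZA.
    * by left.
    * by right; exists q'.
    * by rewrite FA.
Qed.

Lemma obstruction1_left : left_obstruction S obstruction1.
Proof.
have lM := S1 lowS; have tM := S1 tS.
have inX p : in_obstruction1 p -> p \in obstruction1 by move/obstruction1P.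
split; [exact: generic_obstruction1 | exact: obstruction1_avoids |].
exists (F l), E; split; try by apply: inX; constructor.
- by move: lM tM; arith.
- have adj p q c : in_obstruction1 p -> in_obstruction1 q -> in_obstruction1 c ->
      (p.1 < q.1) && (q.2 < p.2) || (q.1 < p.1) && (p.2 < q.2) ->
      (c \<< p) && (c \<< q) -> adjacent obstruction1 p q.
    by move=> pX qX cX ? ?; split; [exact: inX|exact: inX|done|exists c => //; exact: inX].
  (* The path is [F l], [Z], [W], [E], with common lower-left points [m], [G], [G]. *)
  apply: (@connected_step _ _ Z).
    apply: (adj _ _ m (in1F lowS) in1Z in1m); first by move: (S2 lowS); arith.
    by arith.
  apply: (@connected_step _ _ W).
    by apply: (adj _ _ G in1Z in1W in1G); arith.
  apply: (@connected_step _ _ E); last exact: connected_refl.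
  by apply: (adj _ _ G in1W in1E in1G); arith.
move=> T f ef c J cT JT cJ cl Jl EJ.
have f1 p q : in_obstruction1 p -> in_obstruction1 q ->
    p.1 < q.1 -> (f p).1 < (f q).1.
  by move=> /inX pX /inX qX; case: (proj2 ef _ _ pX qX) => ->.
have f2 p q : in_obstruction1 p -> in_obstruction1 q ->
    p.2 < q.2 -> (f p).2 < (f q).2.
  by move=> /inX pX /inX qX; case: (proj2 ef _ _ pX qX) => _ ->.
(* If [c] is to the left of the copy [F], then [c] and [F] form 1 (+) S. Otherwise [J] is in the
   column slot of [t] and above [E], so it completes [Y] to a copy of [S] with [G] below. *)
have [cf|fc] := ltnP c.1 (f (F f0)).1.
  exists c => //; exists (f \o F).
    apply: embI => //= p; first by move=> pS; apply/(proj1 ef)/inX; constructor.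
      move=> q pS qS pq; apply: f1; try by constructor.
      by move: pq; arith.
    move=> q pS qS pq; apply: f2; try by constructor.
    by move: pq; arith.
  move=> p pS; apply/andP; split=> /=.
    have [->//|pf] := eqVneq p f0; apply: (ltn_trans cf).
    apply: f1; try by constructor.
    by move: (generic_neq gS pS fS pf) (f_min pS); arith.
  have [->|pl] := eqVneq p l; first by case/andP: cl.
  case/andP: cl => _ cl; apply: (ltn_trans cl).
  apply: f2; try by constructor.
  by move: (generic_neq gS pS lowS pl) (l_min pS); arith.
have FJ : (f (F f0)).1 < J.1 by move: fc cJ; arith.
have YE p : p \in S -> p != t -> (f (Y p)).2 < J.2.
  move=> pS pt; apply: ltn_trans EJ; apply: f2; try by constructor.
  by move: (S2 pS); arith.
have GY p : p \in S -> p != t -> f G \<< f (Y p).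
  move=> pS pt; apply/andP; split.
    apply: f1; try by constructor.
    by move: (Y1 pS pt); arith.
  by apply: f2; [constructor|constructor|arith].
have GJ : f G \<< J.
  apply/andP; split.
    apply: ltn_trans FJ; apply: f1; try by constructor.
    by arith.
  apply: ltn_trans EJ; apply: f2; try by constructor.
  by arith.
exists (f G); first by apply/(proj1 ef)/inX; constructor.
exists (fun p => if p == t then J else f (Y p)); last first.
  by move=> p pS; case: ifP => [//|/negbT pt]; apply: GY.
apply: embI => //= p.
- by move=> pS; case: ifP => [//|/negbT pt]; apply/(proj1 ef)/inX; constructor.
- move=> q pS qS; case: ifP => [/eqP->|/negbT pt]; case: ifP => [/eqP->|/negbT qt].
  + by rewrite ltnn.
  + move=> tq; apply: (ltn_trans Jl); apply: f1; try by constructor.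
    by move: tq (Y1 qS qt) (S1 lowS); arith.
  + move=> tp; apply: ltn_trans FJ; apply: f1; try by constructor.
    by move: tp (Y1 pS pt) (S1 lowS); arith.
  move=> pq; apply: f1; try by constructor.
  by move: pq (Y1 pS pt) (Y1 qS qt) (S1 pS); arith.
move=> q pS qS; case: ifP => [/eqP->|/negbT pt]; case: ifP => [/eqP->|/negbT qt].
- by rewrite ltnn.
- by rewrite ltnNge t_max.
- by move=> _; apply: YE.
move=> pq; apply: f2; try by constructor.
by move: pq; arith.
Qed.

End TopNotFirst.
Section TopFirst.
(** [E] and [Z] are inserted right after the column of [y0], which is the second or the last point
    of [S] from the left. That [y0] differs from [l] matters when [Z], the lowest point but [m],
    plays [l]. *)
Variable y0 : dot.
Hypothesis t_min : forall p : dot, p \in S -> t.1 <= p.1.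
Hypotheses (y0S : y0 \in S) (y0t : y0 != t) (y0l : y0 != l).
Hypothesis y0_extreme :
  (forall q : dot, q \in S -> q != t -> y0.1 <= q.1) \/
  (forall q : dot, q \in S -> q.1 <= y0.1).

Let Y (p : dot) : dot :=
  (if p.1 <= y0.1 then p.1 + 2 else p.1 + 5, p.2 + 3).
Let m : dot := (0, 0).
Let U : dot := (1, 2).
Let Z : dot := (y0.1 + 4, 1).
Let E : dot := (y0.1 + 3, M + 4).

(* Here the top of S is its first point.  From left to right: m, U, the part of Y
   up to y0, E, Z, the rest of Y; from bottom to top: m, Z, U, Y, E. *)
Definition obstruction2 : config :=
  [:: m; U; Z; E] ++ map Y [seq p <- S | p != t].

Inductive in_obstruction2 : dot -> Prop :=
| in2m : in_obstruction2 m | in2U : in_obstruction2 U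
| in2Z : in_obstruction2 Z | in2E : in_obstruction2 E
| in2Y (p : dot) : p \in S -> p != t -> in_obstruction2 (Y p).

Lemma obstruction2P (p : dot) : p \in obstruction2 <-> in_obstruction2 p.
Proof.
split.
  rewrite !mem_cat !inE -!orbA.
  case/or4P=> [/eqP->|/eqP->|/eqP->|/orP[/eqP->|/mapP[q]]]; try by constructor.
  by rewrite mem_filter => /andP[qt qS] ->; constructor.
case=> [||||q qS qt]; rewrite !mem_cat !inE ?eqxx ?orbT //.
by rewrite map_f ?orbT // mem_filter qt.
Qed.

Lemma Y2 (p : dot) :
  p.1 <= y0.1 /\ (Y p).1 = p.1 + 2 \/ y0.1 < p.1 /\ (Y p).1 = p.1 + 5.
Proof. by rewrite /Y /=; case: leqP => ?; [left|right]. Qed.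

Lemma generic_obstruction2 : generic obstruction2.
Proof.
have [g1 g2] := gS.
split=> p q /obstruction2P hp /obstruction2P hq.
  case: hp => [||||p' pS pt]; case: hq => [||||q' qS qt] //;
  try (move: (Y2 p')); try (move: (Y2 q')); try arith.
  by move=> *; have -> : p' = q' by apply: g1 => //; lia.
case: hp => [||||p' pS pt]; case: hq => [||||q' qS qt] //;
  try (move: (S2 pS)); try (move: (S2 qS)); try arith.
by rewrite /= => *; have -> : p' = q' by apply: g2 => //; lia.
Qed.

Lemma no_emb_Y_E2 f : emb S obstruction2 f ->
  (forall p : dot, p \in S ->
     f p = E \/ exists2 q : dot, q \in S & q != t /\ f p = Y q) -> False.
Proof.
move=> ef im.
have lt1 p : p \in S -> p != t -> (f t).1 < (f p).1.
  move=> pS pt; rewrite (proj1 ((proj2 ef) _ _ tS pS)).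
  by move: (generic_neq gS pS tS pt) (t_min pS); arith.
have lt2 p : p \in S -> p != t -> (f p).2 < (f t).2.
  move=> pS pt; rewrite (proj2 ((proj2 ef) _ _ pS tS)).
  by move: (generic_neq gS pS tS pt) (t_max pS); arith.
have [ftE|[q0 q0S [q0t ftY]]] := im t tS.
(* [E] follows the column of [y0] directly, so it may be read as [y0]. *)
- pose r (p q : dot) := p = t /\ q = y0 \/
    [/\ p != t, y0.1 < q.1 & f p = Y q].
  have : r t t.
    apply: (increasing_selfmap_id gS (r := r)) => //.
      move=> p pS; have [->|pt] := eqVneq p t; first by exists y0 => //; left.
      have [e|[q qS [qt e]]] := im p pS.
        by move: (lt1 _ pS pt); rewrite e ftE ltnn.
      exists q => //; right; split=> //.
      by move: (lt1 _ pS pt) (Y2 q); rewrite e ftE; arith.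
    move=> p p' q q' pS p'S qS q'S h h'.
    have [<- _] := (proj2 ef) _ _ pS p'S.
    case: h h' => [[-> ->]|[pt qt ->]] [[-> ->]|[p't q't ->]] //.
      by rewrite ltnn.
      by rewrite ftE; move: (Y2 q) qt; arith.
    by move: (Y2 q) (Y2 q'); arith.
  case=> [[_ e]|[]]; last by rewrite eqxx.
  by move: y0t; rewrite e eqxx.
- have [] : t != t /\ f t = Y t; last by rewrite eqxx.
  apply: (increasing_selfmap_id gS (r := fun p q => q != t /\ f p = Y q)) => //.
    move=> p pS; have [->|pt] := eqVneq p t; first by exists q0.
    have [e|[q qS h]] := im p pS; last by exists q.
    by move: (lt2 _ pS pt) (S2 q0S); rewrite e ftY; arith.
  move=> p p' q q' pS p'S qS q'S [qt e] [q't e'].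
  have [<- _] := (proj2 ef) _ _ pS p'S; rewrite e e'.
  by move: (Y2 q) (Y2 q'); arith.
Qed.

Lemma obstruction2_avoids : ~ contains_one_plus S obstruction2.
Proof.
move=> [o /obstruction2P oX [f ef fo]].
have fX p : p \in S -> in_obstruction2 (f p).
  by move=> pS; apply/obstruction2P/(proj1 ef).
have lt1 p : p \in S -> p != t -> (f t).1 < (f p).1.
  move=> pS pt; rewrite (proj1 ((proj2 ef) _ _ tS pS)).
  by move: (generic_neq gS pS tS pt) (t_min pS); arith.
have lt2 p : p \in S -> p != t -> (f p).2 < (f t).2.
  move=> pS pt; rewrite (proj2 ((proj2 ef) _ _ pS tS)).
  by move: (generic_neq gS pS tS pt) (t_max pS); arith.
have lt3 p : p \in S -> p != l -> (f l).2 < (f p).2.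
  move=> pS pl; rewrite (proj2 ((proj2 ef) _ _ lowS pS)).
  by move: (generic_neq gS pS lowS pl) (l_min pS); arith.
have lt : l != t by apply/eqP/lowest_neq_top.
have YE : (forall p, p \in S -> f p <> U /\ f p <> Z) -> False.
  move=> h; apply: (no_emb_Y_E2 ef) => p pS; have [hU hZ] := h p pS.
  move: (fo p pS) hU hZ; case: (fX p pS) => [||||q qS qt] // h0 _ _.
  - by left.
  - by right; exists q.
case: oX fo => [||||o' oS ot] fo.
- have [flZ|flZ] := eqVneq (f l) Z; last first.
    have nZ p : p \in S -> f p <> Z.
      move=> pS e; have [pl|pl] := eqVneq p l; first by rewrite -pl e eqxx in flZ.
      by move: (lt3 _ pS pl) (fo _ lowS); rewrite e; arith.
    have := indec_emb_split (A := fun p => p == U) iS ef.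
    case=> [p q pS qS /eqP-> nU | all_U | nU].
    + move: nU (nZ q qS) (fo q qS).
      by case: (fX q qS) => [||||q' q'S qt]; rewrite ?eqxx //; try move: (Y2 q'); arith.
    + by apply: (emb_not_constant ef (e := U)) => p /all_U /eqP.
    + by apply: YE => p pS; split; [apply/eqP/nU|apply: nZ].
  case: y0_extreme => [y0_first | y0_last]; last first.
    (* If [y0] is last, nothing lies to the right of [Z] to be the image of [y0]. *)
    have y1 : l.1 < y0.1.
      by move: (generic_neq gS lowS y0S) (y0_last _ lowS); rewrite eq_sym => /(_ y0l); arith.
    move: (proj1 (proj2 ef _ _ lowS y0S)); rewrite y1 flZ.
    case: (fX _ y0S) => [||||q qS qt]; try by arith.
    by move: (Y2 q) (y0_last _ qS); arith.
  have ft : f t = E \/ f t = Y y0.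
    move: (lt2 _ lowS lt) (lt1 _ lowS lt); rewrite flZ.
    have [c [cS ct cl]] := lS t l.
    case: (fX _ tS) (lt2 _ cS ct) (lt3 _ cS cl) => [||||q qS qt];
      try (rewrite flZ; arith); first by left.
    move=> _ _ _ lt1'; right.
    have [->//|qy] := eqVneq q y0.
    by move: (generic_neq gS qS y0S qy) (y0_first _ qS qt) (Y2 q) lt1'; arith.
  (* If [y0] is second, [t] goes to [E] or [Y y0] and everything else to the right of [E]. Reading
     [Z] as [y0] gives an increasing self-map; it fixes [y0], so [f y0 = Z = f l], against
     [y0 != l]. *)
  pose r (p q : dot) := [/\ p = t & q = t] \/
    [/\ p != t & f p = Z /\ q = y0 \/ y0.1 < q.1 /\ f p = Y q].
  have : r y0 y0.
    apply: (increasing_selfmap_id gS (r := r)) => //.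
      move=> p pS; have [->|pt] := eqVneq p t; first by exists t => //; left.
      move: (fX _ pS) (lt1 _ pS pt) (lt2 _ pS pt); move e: (f p) => fp h.
      case: h e => [||||q qS qt] e l1 l2.
      * by case: ft l1 => ->; arith.
      * by case: ft l1 => ->; move: (Y2 y0); arith.
      * by exists y0 => //; right; split=> //; left.
      * by case: ft l2 => ->; move: (S2 y0S); arith.
      exists q => //; right; split=> //; right; split=> //.
      by case: ft l1 => ->; move: (Y2 y0) (Y2 q); arith.
    move=> p p' q q' pS p'S qS q'S h h'.
    case: h h' => [[-> ->]|[pt h]] [[-> ->]|[p't h']].
    + by rewrite ltnn.
    + move=> _; suff q't : q' != t.
        by move: (generic_neq gS q'S tS q't) (t_min q'S); arith.
      by case: h' => [[_ ->//]|[y1 _]]; apply: contraTneq y1 => ->; rewrite -leqNgt t_min.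
    + by rewrite ltnNge t_min.
    have [<- _] := (proj2 ef) _ _ pS p'S.
    case: h h' => [[-> ->]|[y1 ->]] [[-> ->]|[y1' ->]] //.
    + by arith.
    + by move: y1 (Y2 q); arith.
    by move: (Y2 q) (Y2 q'); arith.
  case=> [[e]|[_ [[e _]|[]]]]; last by rewrite ltnn.
    by move: y0t; rewrite e eqxx.
  by move: (lt3 _ y0S y0l); rewrite e flZ ltnn.
- apply: YE => p pS; have := fo p pS.
  by case: (fX p pS) => [||||q qS qt] h; split=> // e; move: h; try rewrite e; arith.
- apply: YE => p pS; have := fo p pS.
  by case: (fX p pS) => [||||q qS qt] h; split=> // e; move: h; try rewrite e; arith.
- by move: (fo _ tS); case: (fX t tS) => [||||q qS qt]; try (move: (S2 qS)); arith.
- apply: YE => p pS; have := fo p pS.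
  by move=> h; split=> e; move: h; try rewrite e; arith.
Qed.

(** Since [t] is both first and top, a point [J] to the left of [U] and above [E] can take its place
    beside [Y], with [c] as the 1. *)
Lemma obstruction2_left : left_obstruction S obstruction2.
Proof.
have inX p : in_obstruction2 p -> p \in obstruction2 by move/obstruction2P.
split; [exact: generic_obstruction2 | exact: obstruction2_avoids |].
exists U, E; split; try by apply: inX; constructor.
- by arith.
- have adj p q c : in_obstruction2 p -> in_obstruction2 q -> in_obstruction2 c ->
      (p.1 < q.1) && (q.2 < p.2) || (q.1 < p.1) && (p.2 < q.2) ->
      (c \<< p) && (c \<< q) -> adjacent obstruction2 p q.
    by move=> pX qX cX ? ?; split; [exact: inX|exact: inX|done|exists c => //; exact: inX].
  apply: (@connected_step _ _ Z).
    by apply: (adj _ _ m in2U in2Z in2m); arith.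
  apply: (@connected_step _ _ E); last exact: connected_refl.
  by apply: (adj _ _ m in2Z in2E in2m); arith.
move=> T f ef c J cT JT cJ cU JU EJ.
have f1 p q : in_obstruction2 p -> in_obstruction2 q ->
    p.1 < q.1 -> (f p).1 < (f q).1.
  by move=> /inX pX /inX qX; case: (proj2 ef _ _ pX qX) => ->.
have f2 p q : in_obstruction2 p -> in_obstruction2 q ->
    p.2 < q.2 -> (f p).2 < (f q).2.
  by move=> /inX pX /inX qX; case: (proj2 ef _ _ pX qX) => _ ->.
have U1 p : p \in S -> p != t -> (f U).1 < (f (Y p)).1.
  move=> pS pt; apply: f1; try by constructor.
  by move: (Y2 p); arith.
have U2 p : p \in S -> p != t -> (f U).2 < (f (Y p)).2.
  move=> pS pt; apply: f2; try by constructor.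
  by arith.
exists c => //; exists (fun p => if p == t then J else f (Y p)); last first.
  move=> p pS; case: ifP => [//|/negbT pt].
  by move: cU (U1 _ pS pt) (U2 _ pS pt); arith.
apply: embI => //= p.
- by move=> pS; case: ifP => [//|/negbT pt]; apply/(proj1 ef)/inX; constructor.
- move=> q pS qS; case: ifP => [/eqP->|/negbT pt]; case: ifP => [/eqP->|/negbT qt].
  + by rewrite ltnn.
  + by move=> _; apply: (ltn_trans JU); apply: U1.
  + by rewrite ltnNge t_min.
  move=> pq; apply: f1; try by constructor.
  by move: pq (Y2 p) (Y2 q); arith.
move=> q pS qS; case: ifP => [/eqP->|/negbT pt]; case: ifP => [/eqP->|/negbT qt].
- by rewrite ltnn.
- by rewrite ltnNge t_max.
- move=> _; apply: ltn_trans EJ; apply: f2; try by constructor.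
  by move: (S2 pS); arith.
move=> pq; apply: f2; try by constructor.
by move: pq; arith.
Qed.

End TopFirst.
End Obstruction.

(** When the top comes first, the second and the last point cannot both be the lowest one, as [S]
    has a third point; one of them serves as [y0]. *)
Lemma exists_left_obstruction S : generic S -> indecomposable S -> large S ->
  exists X, left_obstruction S X.
Proof.
move=> gS iS lS.
have S0 : S <> [::] by move=> S0; have [c []] := lS (0, 0) (0, 0); rewrite S0.
have [B1 S1] := exists_bound S (@fst nat nat).
have [B2 S2] := exists_bound S (@snd nat nat).
have {}S1 (p : dot) : p \in S -> p.1 <= maxn B1 B2 by move/S1; lia.
have {}S2 (p : dot) : p \in S -> p.2 <= maxn B1 B2 by move/S2; lia.
have [t tS t_max] := exists_max (@snd nat nat) S0.
have [l lowS l_min] := exists_min (@snd nat nat) S0.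
have [f0 fS f_min] := exists_min (@fst nat nat) S0.
have [e|/eqP ft] := eqVneq f0 t; last first.
  exact/ex_intro/(obstruction1_left gS iS lS S1 S2 tS lowS fS).
rewrite e in f_min.
have S'0 : [seq p <- S | p != t] <> [::].
  have [c [cS ct _]] := lS t t => e'.
  by have : c \in [seq p <- S | p != t]; [rewrite mem_filter ct|rewrite e'].
have [y + y_min] := exists_min (@fst nat nat) S'0.
have [z + z_max] := exists_max (@fst nat nat) S'0.
rewrite !mem_filter => /andP[zt zS] /andP[yt yS].
have y_first (q : dot) : q \in S -> q != t -> y.1 <= q.1.
  by move=> qS qt; apply: y_min; rewrite mem_filter qt.
have z_last (q : dot) : q \in S -> q.1 <= z.1.
  move=> qS; have [->|qt] := eqVneq q t; first exact: f_min.
  by apply: z_max; rewrite mem_filter qt.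
have [yl|yl] := eqVneq y l; last first.
  by eexists; apply: (obstruction2_left gS iS lS S2 tS lowS fS t_max l_min
    (y0 := y)) => //; left.
have [zl|zl] := eqVneq z l; last first.
  by eexists; apply: (obstruction2_left gS iS lS S2 tS lowS fS t_max l_min
    (y0 := z)) => //; right.
have [c [cS ct cl]] := lS t l.
have := generic_neq gS cS lowS cl.
by have := y_first _ cS ct; have := z_last _ cS; rewrite yl zl; lia.
Qed.

(** * Layers of the inversion graph *)

Lemma adjacent_sym T (p q : dot) : adjacent T p q -> adjacent T q p.
Proof.
move=> [pT qT inv [c cT /andP[cp cq]]]; split=> //; first by rewrite orbC.
by exists c; rewrite ?cq.
Qed.

Lemma connected_trans T (p q r : dot) :
  connected T p q -> connected T q r -> connected T p r.
Proof.
by elim=> // a b c ab _ IH /IH; apply: connected_step ab.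
Qed.

Lemma connected_sym T (p q : dot) : connected T p q -> connected T q p.
Proof.
elim=> [a|a b c ab _ IH]; first exact: connected_refl.
apply: connected_trans IH _; apply: (connected_step (adjacent_sym ab)).
exact: connected_refl.
Qed.

Lemma adjacent_swap T (p q : dot) :
  adjacent (map swap T) p q <-> adjacent T (swap p) (swap q).
Proof.
split=> -[pT qT inv [c cT /andP[cp cq]]].
  split; rewrite -?mem_swap //; first by rewrite orbC andbC [X in _ || X]andbC.
  exists (swap c); first by rewrite -mem_swap.
  by move: cp cq; rewrite /ll /=; lia.
split; rewrite ?mem_swap //.
  by move: inv; rewrite /=; lia.
exists (swap c); first by rewrite mem_swap; case: c cT {cp cq}.
by move: cp cq; rewrite /ll /=; lia.
Qed.

Lemma connected_swap T (p q : dot) :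
  connected (map swap T) p q -> connected T (swap p) (swap q).
Proof.
elim=> [a|a b c /adjacent_swap ab _ IH]; first exact: connected_refl.
exact: connected_step ab IH.
Qed.

(* [d] behaves like the graph distance to the topmost vertex of each component. *)
Definition layering (T : config) (d : dot -> nat) : Prop :=
  [/\ forall u v : dot, adjacent T u v -> d v <= (d u).+1,
      forall v : dot, v \in T -> 0 < d v ->
        exists2 J : dot, adjacent T J v & d J < d v,
      forall u x : dot, x \in T -> connected T u x -> d u < d x -> ~~ (u \<< x) &
      forall u v : dot, adjacent T u v -> d u = 0 -> d v <> 0].

Lemma layering_swap T d : layering T d -> layering (map swap T) (d \o swap).
Proof.
move=> [d1 d2 d3 d4]; split.
- by move=> u v /adjacent_swap /d1.
- move=> v; rewrite mem_swap => vT /(d2 _ vT) [J Jv lt].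
  by exists (swap J); [apply/adjacent_swap; case: J Jv {lt}|case: J lt {Jv}].
- move=> u x; rewrite mem_swap => xT /connected_swap ux /(d3 _ _ xT ux).
  by rewrite /ll andbC.
- by move=> u v /adjacent_swap /d4.
Qed.

Definition topmost (T : config) (v : dot) : Prop :=
  forall u : dot, u \in T -> connected T v u -> u.2 <= v.2.

(** Walks of length [n] from a highest point of a component; the layer of [v] will be the least such
    [n]. *)
Inductive reachable (T : config) : nat -> dot -> Prop :=
| reachable0 v : v \in T -> topmost T v -> reachable T 0 v
| reachableS n u v : reachable T n u -> adjacent T u v -> reachable T n.+1 v.

Lemma connected_topmost T v : v \in T ->
  exists u : dot, [/\ u \in T, connected T v u & topmost T u].
Proof.
have [B TB] := exists_bound T (@snd nat nat).
have [n] := ubnP (B - v.2); elim: n v => // n IH v vB vT.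
have [tv|] := EM (topmost T v).
  by exists v; split=> //; apply: connected_refl.
rewrite /topmost -existsNE => -[u /not_implyP[uT /not_implyP[vu /negP]]].
rewrite -ltnNge => lt.
have [w [wT uw tw]] : exists w : dot, [/\ w \in T, connected T u w & topmost T w].
  by apply: IH => //; move: vB lt (TB _ uT) (TB _ vT); clear; lia.
by exists w; split=> //; apply: connected_trans vu uw.
Qed.

Lemma reachable_exists T v : v \in T -> exists n, reachable T n v.
Proof.
move=> vT; have [u [uT /connected_sym uv tu]] := connected_topmost vT.
have {uT tu} : exists n, reachable T n u by exists 0; constructor.
by elim: uv {vT} => // a b c ab _ IH [n an]; apply: IH; exists n.+1;
  apply: reachableS an ab.
Qed.

Lemma exists_layering T : generic T -> exists d, layering T d.
Proof.
move=> gT.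
have /choice[d dP] : forall v : dot, exists n, v \in T ->
    reachable T n v /\ forall k, reachable T k v -> n <= k.
  move=> v; have [vT|] := boolP (v \in T); last by exists 0.
  have [n0 n0P] := reachable_exists vT.
  have ex : exists n, `[< reachable T n v >] by exists n0; apply/asboolP.
  exists (ex_minn ex) => _; case: ex_minnP => n /asboolP nP n_min.
  by split=> // k kP; apply/n_min/asboolP.
have d1 u v : adjacent T u v -> d v <= (d u).+1.
  move=> uv; have [uT vT _ _] := uv.
  by apply: (proj2 (dP v vT)); apply: reachableS uv; case: (dP u uT).
have d2 v : v \in T -> 0 < d v -> exists2 J : dot, adjacent T J v & d J < d v.
  move=> vT; have [h _] := dP v vT; case: (d v) h => [//|n] h _.
  inversion h as [|? J ? Jn Jv]; exists J => //; have [JT _ _ _] := Jv.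
  by rewrite ltnS; apply: (proj2 (dP J JT)).
have top v : v \in T -> d v = 0 -> topmost T v.
  move=> vT e; have [+ _] := dP v vT; rewrite e => h.
  by inversion h.
exists d; split=> //.
- move=> u x xT; have [n] := ubnP (d u); elim: n u => // n IH u un ux ltd.
  have uT : u \in T by case: ux xT => // a b c [].
  apply/negP => ulx; have [e|] := posnP (d u).
    have := top u uT e x xT ux; move: ulx; rewrite /ll; clear; lia.
  move=> /(d2 _ uT) [v vu ltv]; have [vT _ inv [c cT /andP[cv cu]]] := vu.
  (* [v] is not adjacent to [x], or else [d x] would be at most [d u]. As [c] is also below and to
     the left of [x], they form no inversion, and [x \<< v] would give [u \<< v]. The descent goes
     on from [v]. *)
  have vx : v \<< x.
    have xv : x != v.
      apply/eqP=> e; move: ltv ltd; rewrite e; lia.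
    have [n1 n2] := generic_neq gT xT vT xv.
    have [//|nvx] := boolP (v \<< x).
    have /d1 : adjacent T v x; last by move: ltv ltd; lia.
    split=> //; first by move: inv n1 n2 nvx ulx; rewrite /ll; clear; lia.
    by exists c => //; rewrite cv; move: cu ulx; rewrite /ll; clear; lia.
  have := IH v; rewrite vx => IHv; have : false; last by [].
  apply: IHv; [by move: un ltv; clear; lia| |by move: ltd ltv; clear; lia].
  exact: connected_step ux.
- move=> u v uv u0 v0; have [uT vT inv _] := uv.
  have vu := top v vT v0 u uT (connected_step (adjacent_sym uv) (connected_refl _ _)).
  have uv' := top u uT u0 v vT (connected_step uv (connected_refl _ _)).
  by move: inv vu uv'; clear; lia.
Qed.

(** * Colouring the configurations that avoid 1 (+) S *)

Lemma adjacent_emb S T f (p q : dot) : emb S T f ->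
  adjacent S p q -> adjacent T (f p) (f q).
Proof.
move=> ef [pS qS inv [c cS /andP[cp cq]]].
split; try exact: (proj1 ef).
  have [-> ->] := proj2 ef _ _ pS qS.
  by have [-> ->] := proj2 ef _ _ qS pS.
by exists (f c); [apply: (proj1 ef)|rewrite !(emb_ll ef) ?cp].
Qed.

(** Adjacent points have layers differing by at most 1, so equal parity makes [d] constant along the
    path from [f u] to [f v]. The predecessor [J] of [f u] is to the left of [f v] but not below it,
    by the third clause of [layering], so the obstruction applies. *)
Lemma avoids_left_obstruction S X T A d (b : bool) : left_obstruction S X ->
  generic T -> layering T d -> ~ contains_one_plus S T -> {subset A <= T} ->
  (forall p : dot, p \in A -> odd (d p) = b) ->
  (forall p : dot, p \in A -> exists2 J : dot, adjacent T J p &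
     d J < d p /\ J.1 < p.1) ->
  ~ emb_into X A.
Proof.
move=> [gX _ [u [v [uX vX uv1 uv obst]]]] gT [d1 d2 d3 d4] nT AT par typ [f ef].
have efT : emb X T f by apply: emb_sub ef.
have [same conn] : d (f u) = d (f v) /\ connected T (f u) (f v).
  elim: uv {uX vX uv1 obst} => [a|a b' c ab _ [<- IH]].
    by split=> //; apply: connected_refl.
  have abT := adjacent_emb efT ab; split; last exact: connected_step IH.
  have [aX bX _ _] := ab.
  move: (par _ (proj1 ef _ aX)) (par _ (proj1 ef _ bX)).
  by move: (d1 _ _ abT) (d1 _ _ (adjacent_sym abT)); clear; lia.
have [J Ju [ltd lt1]] := typ _ (proj1 ef _ uX).
have [JT _ inv [c cT /andP[cJ cu]]] := Ju.
have vT : f v \in T by apply: (proj1 efT).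
have := d3 J _ vT (connected_step Ju conn); rewrite -same => /(_ ltd) nJ.
have nJv : J != f v by apply/eqP => e; move: ltd; rewrite e same ltnn.
apply: nT; apply: (obst T f efT c J) => //.
have := proj1 (proj2 efT _ _ uX vX); rewrite uv1.
by move: (generic_neq gT JT vT nJv) nJ lt1; rewrite /ll; clear; lia.
Qed.

(* [Q] holds for the configurations containing the forbidden pattern. *)
Definition colorable (Q : config -> Prop) : Prop :=
  exists m (R : nat -> config), [/\ 0 < m,
    forall i, i < m -> [/\ generic (R i), R i <> [::] & ~ Q (R i)] &
    forall T, generic T -> ~ Q T -> exists c : dot -> nat,
      (forall p, c p < m) /\
      forall i, i < m -> ~ emb_into (R i) [seq p <- T | c p == i]].

Lemma colorable_one_plus S : generic S -> indecomposable S -> large S ->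
  colorable (contains_one_plus S).
Proof.
move=> gS iS lS.
have [X lX] := exists_left_obstruction gS iS lS.
have iS' : indecomposable (map swap S).
  move=> D sep; have := iS (D \o swap); case.
  - move=> p q pS qS Dp nDq; rewrite /ll andbC.
    by apply: (sep (swap p) (swap q)); rewrite ?mem_swap //; case: (p) (q) pS qS => [? ?] [].
  - by move=> h; left=> p; rewrite mem_swap => /h; case: p.
  - by move=> h; right=> p; rewrite mem_swap => /h; case: p.
have lS' : large (map swap S).
  move=> a b; have [c [cS ca cb]] := lS (swap a) (swap b).
  exists (swap c); split; first by rewrite mem_swap; case: c cS {ca cb}.
    by apply: contraNneq ca => <-; case: (c).
  by apply: contraNneq cb => <-; case: (c).
have [X' lX'] := exists_left_obstruction (generic_swap gS) iS' lS'.
(* The pattern 132, avoided by the points of layer 0. Colours 1 and 2 are for predecessors on the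
   left, 3 and 4 for the others, each by parity of the layer. *)
pose P : config := [:: (0, 0); (1, 2); (2, 1)].
exists 5, (fun i => if i == 0 then P else if i < 3 then X else map swap X').
split=> // [i _|T gT nT].
  case: ifP => _.
    split=> //.
      by split=> p q; rewrite !inE => /or3P[] /eqP-> /or3P[] /eqP->.
    move=> [o oP [f ef fo]].
    have im (p : dot) : p \in S -> f p = (1, 2) \/ f p = (2, 1).
      move=> pS; have := fo p pS; have := proj1 ef _ pS; move: oP.
      by rewrite !inE => /or3P[] /eqP-> /or3P[] /eqP->; auto.
    have [a [aS _ _]] := lS (0, 0) (0, 0).
    have [b [bS ba _]] := lS a a.
    have [c [cS ca cb]] := lS a b.
    have fab := emb_inj gS ef bS aS; have fca := emb_inj gS ef cS aS.
    have fcb := emb_inj gS ef cS bS.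
    have nab : f b <> f a by move/fab => e; rewrite e eqxx in ba.
    have nca : f c <> f a by move/fca => e; rewrite e eqxx in ca.
    have ncb : f c <> f b by move/fcb => e; rewrite e eqxx in cb.
    move: nab nca ncb.
    by case: (im a aS) (im b bS) (im c cS) => [->|->] [->|->] [->|->].
  case: ifP => _.
    by case: lX => gX nX [u [v [uX _ _ _ _]]]; split=> // e; rewrite e in uX.
  case: lX' => gX' nX' [u [v [uX' _]]]; split; first exact: generic_swap.
    by move=> e; move: uX'; rewrite -(swapK_map X') e.
  by move/contains_one_plus_swap; rewrite swapK_map.
have [d dT] := exists_layering gT.
pose left (p : dot) := `[< exists2 J : dot, adjacent T J p & d J < d p /\ J.1 < p.1 >].
pose c (p : dot) := if d p == 0 then 0
                    else if left p then (odd (d p)).+1 else (odd (d p)).+3.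
exists c; split=> [p|i i5].
  by rewrite /c; case: (d p == 0) (left p) (odd (d p)) => [] [] [].
set A := [seq p <- T | c p == i].
have AT : {subset A <= T} by move=> p; rewrite mem_filter => /andP[].
have Ac p : p \in A -> c p = i by rewrite mem_filter => /andP[/eqP].
have [i0|i0] := eqVneq i 0.
  move=> [f ef]; have efT : emb P T f by apply: emb_sub ef.
  have dA p : p \in A -> d p = 0.
    move/Ac; rewrite i0 /c; by case: eqP => // _; case: ifP.
  have [_ _ _ d4] := dT; apply: (d4 (f (1, 2)) (f (2, 1))).
  - by apply: (adjacent_emb efT); split=> //; exists (0, 0).
  - by apply: dA; apply: (proj1 ef).
  - by apply: dA; apply: (proj1 ef).
have d0 p : p \in A -> 0 < d p.
  by move/Ac => e; rewrite lt0n; apply: contra_neq i0; rewrite -e /c => ->.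
case: ifP => i3.
  apply: (avoids_left_obstruction lX gT dT nT AT (b := i == 2)) => p pA.
    have := Ac p pA; rewrite /c -if_neg -lt0n d0 //.
    by case: ifP => _ e; move: i3; rewrite -e; case: (odd _).
  have := Ac p pA; rewrite /c -if_neg -lt0n d0 //.
  by case: ifP => [/asboolP//|_ e]; move: i3; rewrite -e; case: (odd _).
move=> [f /emb_swap]; rewrite swapK_map => ef.
have nT' : ~ contains_one_plus (map swap S) (map swap T).
  move/contains_one_plus_swap; rewrite !swapK_map //.
apply: (avoids_left_obstruction (A := map swap A) (b := i == 4) lX' (generic_swap gT) (layering_swap dT) nT').
- by move=> p; rewrite !mem_swap => /AT.
- move=> p; rewrite mem_swap => pA; have := Ac _ pA.
  rewrite /c -if_neg -lt0n d0 //=.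
  by case: ifP => _ e; move: i3; rewrite -e; case: (odd _).
- move=> p; rewrite mem_swap => pA; have := Ac _ pA.
  have [_ d2 _ _] := dT; have [J Jp lt] := d2 _ (AT _ pA) (d0 _ pA).
  rewrite /c -if_neg -lt0n d0 //.
  case: ifP => [_ e|/asboolP nl _]; first by move: i3; rewrite -e; case: (odd _).
  exists (swap J).
    by apply/adjacent_swap; case: J Jp {lt}.
  split; first by case: J lt {Jp}.
  (* A predecessor not on the left forms an inversion with the point, so it is lower; the swap puts
     it on the left. *)
  have [_ _ inv _] := Jp.
  have : ~~ (J.1 < (swap p).1) by apply/negP => h; apply: nl; exists J.
  by move: inv; rewrite /=; clear; lia.
- by exists (swap \o f \o swap).
Qed.

(** * Greedy colouring for three summands *)

Definition contains_sum (A B T : config) : Prop :=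
  exists f g, [/\ emb A T f, emb B T g &
    forall p q : dot, p \in A -> q \in B -> f p \<< g q].

Lemma contains_sum_sub A B T T' : {subset T <= T'} ->
  contains_sum A B T -> contains_sum A B T'.
Proof.
move=> sTT' [f [g [ef eg fg]]]; exists f, g.
by split=> //; [apply: emb_sub ef|apply: emb_sub eg].
Qed.

Lemma ll_trans (q p r : dot) : p \<< q -> q \<< r -> p \<< r.
Proof. rewrite /ll; lia. Qed.

Section GreedyColoring.
Variables (A B C T : config).
Hypotheses (gT : generic T) (B0 : B <> [::]).

(* Reading from left to right, a point becomes blue if it lies above and to the
   right of a blue point, or if colouring it red would complete a red A + B. *)
Lemma greedy_coloring n : exists red : pred dot,
  [/\ ~ contains_sum A B [seq p <- T | (p.1 < n) && red p],
      forall b : dot, b \in T -> b.1 < n -> ~~ red b ->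
        exists b' : dot, [/\ b' \in T, b' = b \/ b' \<< b &
          exists f g, [/\ emb A T f, emb B T g,
            forall p q : dot, p \in A -> q \in B -> f p \<< g q,
            forall q : dot, q \in B -> g q = b' \/ red (g q) /\ (g q).1 < b'.1 &
            exists2 q : dot, q \in B & g q = b']] &
      forall p b : dot, p \in T -> b \in T -> p.1 < n -> b.1 < n ->
        red p -> ~~ red b -> ~~ (b \<< p)].
Proof.
have [q0 q0B] : exists q0 : dot, q0 \in B.
  by case: (B) B0 => // q ? _; exists q; rewrite mem_head.
elim: n => [|n [red [redP blueP sepP]]].
  exists (fun=> true); split=> //.
  by move=> [f [g [_ [/(_ q0 q0B)]]]]; rewrite mem_filter.
(* By genericity, column [n] holds at most one point. *)
have [[t [tT tn]]|none] := EM (exists t : dot, t \in T /\ t.1 = n); last first.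
  have lt (p : dot) : p \in T -> p.1 < n.+1 -> p.1 < n.
    by move=> pT; have : p.1 <> n by [move=> e; apply: none; exists p|]; lia.
  exists red; split.
  - move=> h; apply: redP; apply: contains_sum_sub h => p.
    by rewrite !mem_filter => /andP[/andP[/lt + ->] pT] => ->.
  - by move=> b bT /(lt b bT); apply: blueP.
  - by move=> p b pT bT /(lt p pT) pn /(lt b bT); apply: sepP.
have lt (p : dot) : p \in T -> p.1 < n.+1 -> p <> t -> p.1 < n.
  move=> pT pn pt; have : p.1 <> n by rewrite -tn => /(proj1 gT _ _ pT tT).
  by move: pn; clear; lia.
have neq (p : dot) : p.1 < n -> (p == t) = false.
  by move=> pn; apply/eqP => e; move: pn; rewrite e tn ltnn.
pose forced := (exists b : dot, [/\ b \in T, b.1 < n, ~~ red b & b \<< t]) \/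
  contains_sum A B [seq p <- T | (p.1 < n) && red p || (p == t)].
pose red' := fun p : dot => if p == t then ~~ `[< forced >] else red p.
have old (b : dot) : b \in T -> b.1 < n -> ~~ red b ->
    exists b' : dot, [/\ b' \in T, b' = b \/ b' \<< b &
          exists f g, [/\ emb A T f, emb B T g,
            forall p q : dot, p \in A -> q \in B -> f p \<< g q,
            forall q : dot, q \in B -> g q = b' \/ red' (g q) /\ (g q).1 < b'.1 &
            exists2 q : dot, q \in B & g q = b']].
  move=> bT bn nb; have [b' [b'T b'b [f [g [ef eg fg gq ex]]]]] := blueP b bT bn nb.
  exists b'; split=> //; exists f, g; split=> // q /gq[->|[rq lq]]; first by left.
  right; split=> //; rewrite /red' neq //; apply: (ltn_trans lq).
  by case: b'b bn => [->//|]; rewrite /ll; clear; lia.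
exists red'; split.
- move=> h; have [F|nF] := EM forced.
    apply: redP; apply: contains_sum_sub h => p; rewrite !mem_filter /red'.
    case: eqP => [_|pt]; first by rewrite asboolT // andbF.
    by move=> /andP[/andP[pn ->] pT]; rewrite pT (lt p).
  apply: nF; right; apply: contains_sum_sub h => p; rewrite !mem_filter /red'.
  case: eqP => [->|pt]; first by rewrite tT orbT.
  by move=> /andP[/andP[pn ->] pT]; rewrite pT (lt p).
- move=> b bT bn; rewrite {1}/red'; case: eqP => [->|bt]; last first.
    by apply: old => //; apply: lt.
  rewrite negbK => /asboolP[[b0 [b0T b0n nb0 b0t]]|[f [g [ef eg fg]]]].
    have [b' [b'T b'b h]] := old b0 b0T b0n nb0; exists b'; split=> //; right.
    by case: b'b => [->//|/ll_trans]; apply.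
  have sub : {subset [seq p <- T | (p.1 < n) && red p || (p == t)] <= T}.
    by move=> p; rewrite mem_filter => /andP[].
  exists t; split=> //; first by left.
  exists f, g; split; [exact: emb_sub ef|exact: emb_sub eg|done| |].
    move=> q /(proj1 eg); rewrite mem_filter => /andP[/orP[/andP[qn rq] _|/eqP]].
      by right; rewrite /red' neq // tn.
    by left.
  (* The rightmost point [t] cannot play a point of [A]. If it played none of [B] either, the copy
     would be entirely red before [t]. *)
  have [//|ng] := EM (exists2 q : dot, q \in B & g q = t).
  case: redP; exists f, g; split=> //; split; try by [case: ef|case: eg].
    move=> p pA; have := proj1 ef _ pA; rewrite !mem_filter.
    case/andP=> /orP[->->//|/eqP e _].
    move: (fg p q0 pA q0B) (proj1 eg _ q0B); rewrite mem_filter e /ll tn.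
    move=> h /andP[/orP[/andP[lt' _]|/eqP e'] _]; move: h; last by rewrite e' tn ltnn.
    by move: lt'; clear; lia.
  move=> q qB; have := proj1 eg _ qB; rewrite !mem_filter.
  by case/andP=> /orP[->->//|/eqP e _]; case: ng; exists q.
- move=> p b pT bT pn bn; rewrite /red'.
  case: eqP => [->|pt]; case: eqP => [->|bt].
  + by move=> ->.
  + move=> /asboolPn nF nb; apply/negP => bt'; apply: nF; left; exists b.
    by split=> //; apply: lt.
  + by rewrite /ll tn; move: pn; clear; lia.
  by apply: sepP => //; apply: lt.
Qed.

(** Given a blue copy [g], [h] of B + C, the lowest point of [g] has a witness [b'] with a copy [f],
    [k] of A + B. If [k] is below and to the left of [h], then [f], [k], [h] is forbidden; otherwise
    [f], [g], [h] is. *)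
Lemma sum_coloring :
  ~ (exists f g h, [/\ emb A T f, emb B T g, emb C T h,
       forall p q : dot, p \in A -> q \in B -> f p \<< g q &
       forall p q : dot, p \in B -> q \in C -> g p \<< h q]) ->
  exists red : pred dot,
    ~ contains_sum A B [seq p <- T | red p] /\
    ~ contains_sum B C [seq p <- T | ~~ red p].
Proof.
move=> nABC; have [n Tn] := exists_bound T (@fst nat nat).
have [red [redP blueP sepP]] := greedy_coloring n.+1; exists red; split.
  move=> h; apply: redP; apply: contains_sum_sub h => p; rewrite !mem_filter.
  by move=> /andP[-> pT]; rewrite pT ltnS Tn.
move=> [g [h [eg eh gh]]].
have sub : {subset [seq p <- T | ~~ red p] <= T}.
  by move=> p; rewrite mem_filter => /andP[].
have egT : emb B T g by apply: emb_sub eg.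
have ehT : emb C T h by apply: emb_sub eh.
have [b0 b0B b0_min] := exists_min (fun p => (g p).2) B0.
have := proj1 eg _ b0B; rewrite mem_filter => /andP[nb bT].
have [b' [b'T b'b [f [k [ef ek fk kP [q0 q0B kq0]]]]]] :=
  blueP _ bT (Tn _ bT : _ < n.+1) nb.
have b'b1 : b'.1 <= (g b0).1 by case: b'b => [->//|]; rewrite /ll; lia.
have b'b2 : b'.2 <= (g b0).2 by case: b'b => [->//|]; rewrite /ll; lia.
have [kh|] := EM (forall p q : dot, p \in B -> q \in C -> k p \<< h q).
  by apply: nABC; exists f, k, h.
rewrite -existsNE => -[p1]; rewrite -existsNE => -[r /not_implyP[p1B /not_implyP[rC /negP nkh]]].
have lr := gh _ _ b0B rC.
have [e|[rk lk]] := kP _ p1B.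
  by move: nkh lr b'b1 b'b2; rewrite e /ll; clear; lia.
have kT : k p1 \in T by apply: (proj1 ek).
(* The red point [k p1] is to the left of [h r], hence above it and above all of [g]. Not being
   above and to the right of a blue point, it is not to the right of [g q], so [f p] is left of
   [g q]; it is lower because it is below [b']. *)
apply: nABC; exists f, g, h; split=> // p q pA qB.
have fp1 := fk _ _ pA p1B; have fb' := fk _ _ pA q0B; rewrite kq0 in fb'.
have := proj1 eg _ qB; rewrite mem_filter => /andP[nq qT].
have nqk := sepP _ _ kT qT (Tn _ kT : _ < n.+1) (Tn _ qT : _ < n.+1) rk nq.
have hq := gh _ _ qB rC; have mq := b0_min _ qB.
move: fp1 fb' nqk hq mq nkh lr b'b1 b'b2 lk; rewrite /ll; clear; lia.
Qed.

End GreedyColoring.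

(** * From configurations to permutations *)

Lemma subseq_positions (u s : seq nat) : subseq u s ->
  exists I, [/\ sorted ltn I, forall i, i < size I -> nth 0 I i < size s &
                u = [seq nth 0 s i | i <- I]].
Proof.
move=> /subseqP[m sm ->]; exists (mask m (iota 0 (size s))); split.
- by apply: (subseq_sorted ltn_trans (mask_subseq _ _)); apply: iota_ltn_sorted.
- by move=> i /(mem_nth 0) /mem_mask; rewrite mem_iota.
- by rewrite map_mask map_nth_iota0 // take_size.
Qed.

Lemma subseq_graph (s t : seq nat) : uniq t ->
  (exists u, subseq u s /\ order_iso u t) <-> emb_into (graph t) (graph s).
Proof.
move=> ut; split.
  move=> [u [/subseq_positions[I [I_sorted I_lt uE]] [su ou]]].
  have sI : size I = size t by rewrite -su uE size_map.
  exists (fun p => (nth 0 I p.1, nth 0 s (nth 0 I p.1))).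
  apply: embI; first exact: generic_graph.
  - by move=> p; rewrite !mem_graph /= -sI => /andP[/I_lt -> _] /=.
  - move=> p q; rewrite !mem_graph -sI => /andP[pI _] /andP[qI _] /=.
    exact: (sorted_ltn_nth ltn_trans).
  move=> p q; rewrite !mem_graph -sI => /andP[pI /eqP->] /andP[qI /eqP->] /=.
  by rewrite -ou ?su -?sI // uE !(nth_map 0).
move=> [f [f1 f2]].
pose I := [seq (f (i, nth 0 t i)).1 | i <- iota 0 (size t)].
have tG i : i < size t -> (i, nth 0 t i) \in graph t.
  by move=> it; rewrite mem_graph it eqxx.
have nI i : i < size t -> nth 0 I i = (f (i, nth 0 t i)).1.
  by move=> it; rewrite (nth_map 0) ?size_iota // nth_iota.
have fI i : i < size t ->
    nth 0 I i < size s /\ nth 0 s (nth 0 I i) = (f (i, nth 0 t i)).2.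
  by move=> it; have := f1 _ (tG i it); rewrite mem_graph nI // => /andP[? /eqP->].
have sI : size I = size t by rewrite size_map size_iota.
have I_sorted : sorted ltn I.
  apply/(sortedP 0) => i; rewrite sI => it; have it' := ltnW it.
  by rewrite /= !nI // (proj1 (f2 _ _ (tG i it') (tG i.+1 it))) /=.
exists [seq nth 0 s i | i <- I]; split.
  have -> : I = [seq i <- iota 0 (size s) | i \in I].
    apply: (irr_sorted_eq ltn_trans ltnn) => //.
      by apply: sorted_filter; [apply: ltn_trans|apply: iota_ltn_sorted].
    move=> i; rewrite mem_filter mem_iota /= add0n.
    case iI: (i \in I) => //=; symmetry.
    by move/(nthP 0): iI => [j]; rewrite sI => /fI[? _] <-.
  rewrite [X in subseq _ X](_ : s = [seq nth 0 s i | i <- iota 0 (size s)]);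
    last by rewrite map_nth_iota0 // take_size.
  exact/map_subseq/filter_subseq.
split; first by rewrite size_map sI.
rewrite size_map sI => i j it jt.
rewrite !(nth_map 0 0 (nth 0 s)) ?sI // (proj2 (fI i it)) (proj2 (fI j jt)).
by rewrite (proj2 (f2 _ _ (tG i it) (tG j jt))).
Qed.

Lemma permutation_uniq (s : permutation) : uniq s.
Proof.
by case: s => s /= /andP[_ /perm_uniq ->]; apply: iota_uniq.
Qed.

Lemma mem_permutation (s : permutation) x : (x \in pseq s) = (0 < x <= size s).
Proof.
by case: s => s /= /andP[_ /perm_mem ->]; rewrite mem_iota; lia.
Qed.

Lemma size_permutation (s : permutation) : 0 < size s.
Proof. by case: s => s /= /andP[]. Qed.

Lemma graph_permutation (s : permutation) (p : dot) :
  p \in graph s -> [/\ p.1 < size s, 0 < p.2 & p.2 <= size s].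
Proof.
rewrite mem_graph => /andP[ps /eqP e]; split=> //;
  by have := mem_nth 0 ps; rewrite -e mem_permutation => /andP[].
Qed.

Lemma graph_neq0 (s : permutation) : graph s <> [::].
Proof.
by move=> /(congr1 size); rewrite size_map size_iota => e; have := size_permutation s; rewrite e.
Qed.

Lemma contains_graph (pi sigma : permutation) :
  contains pi sigma <-> emb_into (graph sigma) (graph pi).
Proof. exact/subseq_graph/permutation_uniq. Qed.

Lemma emb_into_trans S T U : emb_into S T -> emb_into T U -> emb_into S U.
Proof. by move=> [f ef] [g eg]; exists (g \o f); apply: emb_comp ef eg. Qed.

Lemma emb_into_size (s t : permutation) :
  emb_into (graph s) (graph t) -> size s <= size t.
Proof. by move=> /contains_graph[u [/size_subseq le [<- _]]]. Qed.

(** Each entry is replaced by its rank in the sorted list, counted from 1. *)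
Lemma standardization (s : seq nat) : uniq s -> s <> [::] ->
  exists sigma : permutation, order_iso s sigma.
Proof.
move=> us s0; pose ss := sort leq s; pose r x := (index x ss).+1.
have uss : uniq ss by rewrite sort_uniq.
have ss_sorted : sorted ltn ss.
  by rewrite ltn_sorted_uniq_leq uss sort_sorted //; apply: leq_total.
have rP : is_permutation (map r s).
  rewrite /is_permutation size_map; apply/andP; split; first by case: s s0 {us ss r uss ss_sorted}.
  have -> : iota 1 (size s) = map r ss.
    apply: (@eq_from_nth _ 0); first by rewrite size_map size_iota size_sort.
    move=> i; rewrite size_iota => is_; rewrite nth_iota // (nth_map 0) ?size_sort //.
    by rewrite /r index_uniq ?size_sort.
  by apply: perm_map; rewrite perm_sym perm_sort.
exists (Permutation rP); split; first by rewrite size_map.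
move=> i j is_ js; rewrite /= !(nth_map 0) // /r ltnS.
have lt x y : x \in ss -> y \in ss -> index x ss < index y ss -> x < y.
  move=> xs ys; apply: (sorted_ltn_index ltn_trans) => //.
have is' : nth 0 s i \in ss by rewrite mem_sort mem_nth.
have js' : nth 0 s j \in ss by rewrite mem_sort mem_nth.
apply/idP/idP; last exact: lt.
move=> ij; rewrite ltnNge leq_eqVlt negb_or; apply/andP; split.
  by apply/eqP => e; move: ij; rewrite -(nth_index 0 is') -(nth_index 0 js') e ltnn.
by apply/negP => /(lt _ _ js' is'); lia.
Qed.

Lemma order_iso_emb (s : seq nat) (sigma : permutation) :
  order_iso s sigma -> emb_into (graph sigma) (graph s).
Proof.
by move=> h; apply/subseq_graph; [apply: permutation_uniq|exists s].
Qed.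

Lemma config_permutation T : generic T -> T <> [::] ->
  exists sigma : permutation,
    emb_into (graph sigma) T /\ emb_into T (graph sigma).
Proof.
move=> [g1 g2] T0; pose le (p q : dot) := p.1 <= q.1.
have le_trans : transitive le by move=> y x z; apply: leq_trans.
pose T' := sort le (undup T).
have memT' p : (p \in T') = (p \in T) by rewrite mem_sort mem_undup.
have uT' : uniq T' by rewrite sort_uniq undup_uniq.
have sT' : sorted le T' by apply: sort_sorted => p q; apply: leq_total.
pose s := [seq (p : dot).2 | p <- T'].
have us : uniq s.
  rewrite map_inj_in_uniq // => p q; rewrite !memT' => pT qT.
  exact: g2.
have s0 : s <> [::].
  move=> e; have [p pT _] := exists_min (@fst nat nat) T0.
  by have : p.2 \in s; [apply: map_f; rewrite memT'|rewrite e].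
have [sigma [ssz so]] := standardization us s0.
have size_s : size s = size T' by rewrite size_map.
have nT i : i < size T' -> nth (0, 0) T' i \in T by move=> iT; rewrite -memT' mem_nth.
have T1 i j : i < size T' -> j < size T' -> i < j ->
    (nth (0, 0) T' i).1 < (nth (0, 0) T' j).1.
  move=> iT jT ij.
  have le1 : (nth (0, 0) T' i).1 <= (nth (0, 0) T' j).1.
    exact: (sorted_ltn_nth le_trans (0, 0) sT' _ _ iT jT ij).
  have : nth (0, 0) T' i != nth (0, 0) T' j by rewrite nth_uniq // neq_ltn ij.
  rewrite ltn_neqAle le1 andbT; apply: contra_neq => e.
  exact: g1 (nT i iT) (nT j jT) e.
have sE i : i < size T' -> nth 0 s i = (nth (0, 0) T' i).2.
  by move=> iT; rewrite (nth_map (0, 0)).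
exists sigma; split.
  exists (fun p => nth (0, 0) T' p.1); apply: embI.
  - exact/generic_graph/permutation_uniq.
  - by move=> p; rewrite mem_graph -ssz size_s => /andP[/nT].
  - move=> p q; rewrite !mem_graph -ssz size_s => /andP[pT _] /andP[qT _].
    exact: T1.
  move=> p q; rewrite !mem_graph -ssz size_s => /andP[pT /eqP->] /andP[qT /eqP->].
  by rewrite -!sE // so ?size_s.
have iT p : p \in T -> index p T' < size T' by rewrite index_mem memT'.
exists (fun p => (index p T', nth 0 sigma (index p T'))); apply: embI => //.
- by move=> p pT; rewrite mem_graph /= eqxx -ssz size_s iT.
- move=> p q pT qT pq /=; rewrite ltnNge leq_eqVlt; apply/negP => /orP[/eqP e|lt].
    have : p = q by rewrite -(nth_index (0, 0) (_ : p \in T')) ?memT' // -e nth_index ?memT'.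
    by move=> e'; move: pq; rewrite e' ltnn.
  have := T1 _ _ (iT _ qT) (iT _ pT) lt; rewrite !nth_index ?memT' //.
  by move: pq; clear; lia.
move=> p q pT qT pq /=; rewrite -so ?size_s ?iT // !sE ?iT //.
by rewrite !nth_index ?memT'.
Qed.

(** The parts are [Av (rho i)], where [rho i] is the permutation drawn by [R i]. None contains
    [Av pi], because [rho i] avoids [pi] but not itself. *)
Lemma splittable_colorable (pi : permutation) :
  colorable (emb_into (graph pi)) -> splittable (Av pi).
Proof.
move=> [m [R [m0 RP Rcol]]].
have /choice[rho rhoP] : forall i : 'I_m, exists sigma : permutation,
    emb_into (graph sigma) (R i) /\ emb_into (R i) (graph sigma).
  by move=> i; have [gR R0 _] := RP i (ltn_ord i); apply: config_permutation.
exists m, (fun i => Av (rho i)); split=> //; split; last first.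
  move=> i sub; have [_ _ nQ] := RP i (ltn_ord i).
  have : Av (rho i) (rho i).
    apply: sub => /contains_graph h; apply: nQ; apply: emb_into_trans h _.
    by case: (rhoP i).
  by apply; apply/contains_graph; exists id; split.
split=> [i|h hpi]; first exact: Av_permutation_class.
have uh := permutation_uniq h.
have nh : ~ emb_into (graph pi) (graph h) by move/contains_graph.
have [c [cm cP]] := Rcol _ (generic_graph uh) nh.
(* [odot] colours values and [c] colours points: the value [v] gets the colour of its point in the
   graph of [h]. *)
exists (fun v => Ordinal (cm (index v (pseq h), v))) => i s.
have [->|s0] := EM (s = [::]); [by left|right].
have sh : subseq s h by apply: filter_subseq.
have us : uniq s by apply: subseq_uniq sh uh.
have [sigma ss] := standardization us s0; exists sigma => //.
move=> /contains_graph h1; apply: (cP i (ltn_ord i)).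
apply: emb_into_trans (proj2 (rhoP i)) (emb_into_trans h1 _).
apply: emb_into_trans (order_iso_emb ss) _.
have [I [I_sorted I_lt sE]] := subseq_positions sh.
have idx k : k < size I -> index (nth 0 s k) (pseq h) = nth 0 I k.
  by move=> iI; rewrite sE (nth_map 0) // index_uniq // I_lt.
have sI : size s = size I by rewrite sE size_map.
exists (fun p => (index p.2 (pseq h), p.2)); apply: embI => [|p|p q|//].
- exact: generic_graph.
- rewrite mem_graph => /andP[ps /eqP pE].
  have : p.2 \in s by rewrite pE mem_nth.
  rewrite mem_filter => /andP[cp ph]; rewrite mem_filter.
  by apply/andP; split; [exact: cp|]; rewrite mem_graph /= index_mem ph nth_index /=.
rewrite !mem_graph sI => /andP[pI /eqP->] /andP[qI /eqP->] pq /=.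
by rewrite !idx //; apply: (sorted_ltn_nth ltn_trans).
Qed.

(** * Direct sums and splittings from three summands *)

Lemma mem_graph_dsum (s t : permutation) (p : dot) :
  (p \in graph (dsum s t)) =
  if p.1 < size s then p \in graph s
  else (size s < p.2) && ((p.1 - size s, p.2 - size s) \in graph t).
Proof.
rewrite !mem_graph /= size_cat size_map nth_cat.
case: (ltnP p.1 (size s)) => ps; first by rewrite ltn_addr.
have -> : (p.1 < size s + size t) = (p.1 - size s < size t) by lia.
case: ltnP => [pt|]; last by rewrite andbF.
rewrite (nth_map 0) //= .
have : 0 < nth 0 t (p.1 - size s).
  by have := mem_nth 0 pt; rewrite mem_permutation => /andP[].
lia.
Qed.

Lemma emb_dsum (s t : permutation) T f g :
  emb (graph s) T f -> emb (graph t) T g ->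
  (forall p q : dot, p \in graph s -> q \in graph t -> f p \<< g q) ->
  exists h, emb (graph (dsum s t)) T h /\
    forall p : dot, p \in graph (dsum s t) ->
      (exists2 q : dot, q \in graph s & h p = f q) \/
      (exists2 q : dot, q \in graph t & h p = g q).
Proof.
move=> ef eg fg.
pose u (p : dot) : dot := (p.1 - size s, p.2 - size s).
exists (fun p => if p.1 < size s then f p else g (u p)); split; last first.
  move=> p; rewrite mem_graph_dsum; case: ifP => _; first by left; exists p.
  by case/andP=> _ pt; right; exists (u p).
apply: embI.
- exact/generic_graph/permutation_uniq.
- move=> p; rewrite mem_graph_dsum; case: ifP => _; first exact: (proj1 ef).
  by case/andP=> _; apply: (proj1 eg).
- move=> p q; rewrite !mem_graph_dsum; case: (ltnP p.1 (size s)) => ps; case: (ltnP q.1 (size s)) => qs pT qT pq.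
  + by rewrite (proj1 (proj2 ef _ _ pT qT)).
  + by case/andP: qT => _ qT; case/andP: (fg _ _ pT qT).
  + by move: pq ps qs; clear; lia.
  case/andP: pT => _ pT; case/andP: qT => _ qT.
  by rewrite (proj1 (proj2 eg _ _ pT qT)) /=; lia.
move=> p q; rewrite !mem_graph_dsum; case: (ltnP p.1 (size s)) => ps; case: (ltnP q.1 (size s)) => qs pT qT pq.
- by rewrite (proj2 (proj2 ef _ _ pT qT)).
- by case/andP: qT => _ qT; case/andP: (fg _ _ pT qT).
- case/andP: pT => pT _; have [_ _] := graph_permutation qT.
  by move: pq pT; clear; lia.
case/andP: pT => p1 pT; case/andP: qT => q1 qT.
by rewrite (proj2 (proj2 eg _ _ pT qT)) /=; lia.
Qed.

Lemma contains_sum_dsum (s t : permutation) T :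
  contains_sum (graph s) (graph t) T <-> emb_into (graph (dsum s t)) T.
Proof.
split=> [[f [g [ef eg fg]]]|[h eh]].
  by have [h [eh _]] := emb_dsum ef eg fg; exists h.
pose u (p : dot) : dot := (p.1 + size s, p.2 + size s).
have sS p : p \in graph s -> p \in graph (dsum s t).
  by move=> pS; rewrite mem_graph_dsum; case: (graph_permutation pS) => ->.
have tS p : p \in graph t -> u p \in graph (dsum s t).
  move=> pT; rewrite mem_graph_dsum /= ltnNge leq_addl /= !addnK.
  case: (graph_permutation pT) => _ p2 _; rewrite -surjective_pairing pT andbT.
  by lia.
exists h, (h \o u); split.
- by apply: emb_sub eh => // p /sS.
- split=> [p /tS|p q /tS pT /tS qT]; first exact: (proj1 eh).
  by have [-> ->] := proj2 eh _ _ pT qT; rewrite /= !ltn_add2r.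
move=> p q pS qT; rewrite (emb_ll eh (sS _ pS) (tS _ qT)).
have [p1 _ p2] := graph_permutation pS; have [q1 q2 _] := graph_permutation qT.
by rewrite /ll /=; lia.
Qed.

Lemma is_permutation1 : is_permutation [:: 1]. Proof. by []. Qed.
Definition unit_perm : permutation := Permutation is_permutation1.

Lemma graph_unit_perm (p : dot) : (p \in graph unit_perm) = (p == (0, 1)).
Proof. by rewrite inE. Qed.

Lemma size1_unit_perm (s : permutation) : size s = 1 -> s = unit_perm.
Proof.
case: s => s sP /= s1; apply/val_inj => /=; case/andP: sP => _.
by rewrite s1 => /perm_small_eq; apply.
Qed.

(** The chain [a], [b], [c] only has to force [pi], so a point may be inserted between two summands.
    The size bounds keep [pi] out of a + b and b + c, which makes the splitting nontrivial. *)
Lemma splittable_three (a b c pi : permutation) :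
  (forall T f g h, emb (graph a) T f -> emb (graph b) T g -> emb (graph c) T h ->
    (forall p q : dot, p \in graph a -> q \in graph b -> f p \<< g q) ->
    (forall p q : dot, p \in graph b -> q \in graph c -> g p \<< h q) ->
    emb_into (graph pi) T) ->
  size a + size b < size pi -> size b + size c < size pi -> splittable (Av pi).
Proof.
move=> pi_sub ab bc; apply: splittable_colorable.
exists 2, (fun i => if i == 0 then graph (dsum a b) else graph (dsum b c)).
split=> // [i _|T gT npi].
  case: ifP => _; split; try exact/generic_graph/permutation_uniq; try exact: graph_neq0;
    by move/emb_into_size; rewrite /= size_cat size_map; lia.
have [|red [red_ab blue_bc]] :=
  sum_coloring (A := graph a) (C := graph c) gT (@graph_neq0 b).
  by move=> [f [g [h [ef eg eh fg gh]]]]; apply: npi; apply: pi_sub ef eg eh fg gh.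
exists (fun p => if red p then 0 else 1); split=> [p|i _]; first by case: ifP.
case: i => [|i] /=; move/contains_sum_dsum => h.
  by apply: red_ab; apply: contains_sum_sub h => p; rewrite !mem_filter; case: (red p) => //= /andP[].
by apply: blue_bc; apply: contains_sum_sub h => p; rewrite !mem_filter; case: (red p) => //= /andP[].
Qed.

Lemma splittable_dsum_large (s t : permutation) :
  1 < size s -> 1 < size t -> splittable (Av (dsum s t)).
Proof.
move=> s1 t1; apply: (@splittable_three s unit_perm t); try by rewrite /= ?(size_cat, size_map); lia.
move=> T f g h ef eg eh fg gh; apply/contains_sum_dsum; exists f, h; split=> // p q ps qt.
by apply: ll_trans (fg p (0, 1) ps _) (gh (0, 1) q _ qt); rewrite graph_unit_perm.
Qed.

Lemma splittable_dsum3r (a b c : permutation) :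
  splittable (Av (dsum a (dsum b c))).
Proof.
have a0 := size_permutation a; have c0 := size_permutation c.
apply: (@splittable_three a b c); try by rewrite /= ?(size_cat, size_map); lia.
move=> T f g h ef eg eh fg gh; apply/contains_sum_dsum.
have [k [ek kP]] := emb_dsum eg eh gh; exists f, k; split=> // p q pa qbc.
case: (kP _ qbc) => -[r rb ->]; first exact: fg.
have [r0 r0b _] := exists_min (@fst nat nat) (@graph_neq0 b).
exact: ll_trans (fg _ _ pa r0b) (gh _ _ r0b rb).
Qed.

Lemma splittable_dsum3l (a b c : permutation) :
  splittable (Av (dsum (dsum a b) c)).
Proof.
have a0 := size_permutation a; have c0 := size_permutation c.
apply: (@splittable_three a b c); try by rewrite /= ?(size_cat, size_map); lia.
move=> T f g h ef eg eh fg gh; apply/contains_sum_dsum.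
have [k [ek kP]] := emb_dsum ef eg fg; exists k, h; split=> // p q pab qc.
case: (kP _ pab) => -[r rb ->]; last exact: gh.
have [r0 r0b _] := exists_min (@fst nat nat) (@graph_neq0 b).
exact: ll_trans (fg _ _ rb r0b) (gh _ _ r0b qc).
Qed.

(** * Indecomposable summands and reverse-complement *)

Lemma large_graph (s : permutation) : 2 < size s -> large (graph s).
Proof.
move=> s2 a b; pose g i : dot := (i, nth 0 s i).
have gS i : i < 3 -> g i \in graph s.
  by move=> i3; rewrite mem_graph eqxx andbT; apply: leq_trans i3 s2.
have gi i j : g i = g j -> i = j by case.
have [n0|/norP[? ?]] := boolP ((g 0 == a) || (g 0 == b)); last by exists (g 0); rewrite gS.
have [n1|/norP[? ?]] := boolP ((g 1 == a) || (g 1 == b)); last by exists (g 1); rewrite gS.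
have [n2|/norP[? ?]] := boolP ((g 2 == a) || (g 2 == b)); last by exists (g 2); rewrite gS.
by case/orP: n0 => /eqP e0; case/orP: n1 => /eqP e1; case/orP: n2 => /eqP e2;
  first [have /gi : g 0 = g 1 by congruence | have /gi : g 0 = g 2 by congruence |
         have /gi : g 1 = g 2 by congruence].
Qed.

(** A proper [D] consists of the first [k] positions, and their values are below all the others.
    Sorting both halves gives the two intervals of values, hence a decomposition of [s]. *)
Lemma indecomposable_graph (s : permutation) :
  ~ decomposable s -> indecomposable (graph s).
Proof.
move=> ns D sep; have [allD|] := EM (forall p : dot, p \in graph s -> D p); first by left.
rewrite -existsNE => -[q0 /not_implyP[q0S /negP nq0]]; right=> p pS; apply/negP => Dp.
pose g i : dot := (i, nth 0 s i).
have gS i : i < size s -> g i \in graph s by move=> ?; rewrite mem_graph /= eqxx andbT.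
have gE (q : dot) : q \in graph s -> q = g q.1.
  by rewrite mem_graph /g => /andP[_ /eqP <-]; case: q.
have ex : exists k, (k < size s) && ~~ D (g k).
  by exists q0.1; rewrite -gE // nq0 andbT; case: (graph_permutation q0S).
case: (ex_minnP ex) => k /andP[ks nDk] k_min.
have DP i : i < size s -> D (g i) = (i < k).
  move=> is_; apply/idP/idP => [Di|ik].
    by case/andP: (sep _ _ (gS _ is_) (gS _ ks) Di nDk).
  by apply: contraLR ik => nDi; rewrite -leqNgt k_min // is_.
have k0 : 0 < k.
  have p1 : p.1 < size s by case: (graph_permutation pS).
  by move: Dp; rewrite (gE _ pS) DP //; case: (k).
have us := permutation_uniq s.
have lt x y : x \in take k s -> y \in drop k s -> x < y.
  move=> /(nthP 0)[i]; rewrite size_takel ?(ltnW ks) // => ik <-.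
  move=> /(nthP 0)[j]; rewrite size_drop => jk <-; rewrite nth_take // nth_drop.
  have is_ : i < size s := ltn_trans ik ks.
  have js : k + j < size s by rewrite -ltn_subRL.
  have /andP[_] // : g i \<< g (k + j).
  by apply: sep; rewrite ?gS ?DP // -leqNgt leq_addr.
have sortE : sort leq (take k s) ++ sort leq (drop k s) = iota 1 (size s).
  apply: (sorted_eq leq_trans anti_leq).
  - have := sort_sorted leq_total (take k s); have := sort_sorted leq_total (drop k s).
    rewrite !(sorted_pairwise leq_trans) pairwise_cat => -> ->; rewrite !andbT.
    by apply/allrelP => x y; rewrite !mem_sort => xs ys; apply/ltnW/lt.
  - exact: iota_sorted.
  have /andP[_ sP] := permutationP s; apply: perm_trans _ sP.
  by rewrite -{3}(cat_take_drop k s) perm_cat // perm_sort.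
have sz1 : size (sort leq (take k s)) = k by rewrite size_sort size_takel // ltnW.
have st : sort leq (take k s) = iota 1 k.
  have <- : take k (iota 1 (size s)) = iota 1 k.
    by rewrite take_iota; congr iota; apply/minn_idPl/ltnW.
  by rewrite -sortE take_size_cat.
have sd : sort leq (drop k s) = iota (1 + k) (size s - k).
  by rewrite -drop_iota -sortE drop_size_cat.
have pa : is_permutation (take k s).
  rewrite /is_permutation size_takel ?(ltnW ks) // k0 /=.
  by rewrite -st perm_sym perm_sort.
have ds x : x \in drop k s -> k < x.
  by rewrite -(mem_sort leq) sd mem_iota; lia.
have pb : is_permutation [seq x - k | x <- drop k s].
  rewrite /is_permutation size_map size_drop subn_gt0 ks /=.
  have -> : iota 1 (size s - k) = [seq x - k | x <- sort leq (drop k s)].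
    by rewrite sd [1 + k]addnC iotaDl -map_comp map_id_in // => x _ /=; rewrite addKn.
  by apply: perm_map; rewrite perm_sym perm_sort.
apply: ns; exists (Permutation pa), (Permutation pb); apply/val_inj => /=.
rewrite -[LHS](cat_take_drop k); congr cat.
rewrite size_takel ?(ltnW ks) // -map_comp map_id_in // => x /ds /= kx; lia.
Qed.

(** Coordinates are subtracted from upper bounds, so truncated subtraction is exact, and involutive,
    on [T]. *)
Lemma exists_reverse_complement T : generic T ->
  exists T' f g, [/\ generic T', anti_emb T T' f, anti_emb T' T g,
    {in T, cancel f g} & map f T = T'].
Proof.
move=> [g1 g2].
have [N1 T1] := exists_bound T (@fst nat nat).
have [N2 T2] := exists_bound T (@snd nat nat).
pose r (p : dot) : dot := (N1 - p.1, N2 - p.2).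
have rK (p : dot) : p \in T -> r (r p) = p.
  move=> pT; move: (T1 _ pT) (T2 _ pT); case: p {pT} => a b /= ? ?.
  by rewrite /r /= !subKn.
exists (map r T), r, r; split=> //.
- split=> p q /mapP[a aT ->] /mapP[b bT ->] /= e; congr r.
    by apply: g1 => //; move: e (T1 _ aT) (T1 _ bT); clear; lia.
  by apply: g2 => //; move: e (T2 _ aT) (T2 _ bT); clear; lia.
- split=> [p pT|p q pT qT]; first exact: map_f.
  move: (T1 _ pT) (T1 _ qT) (T2 _ pT) (T2 _ qT); rewrite /=; clear.
  by move=> *; split; lia.
- split=> [p /mapP[a aT ->]|p q /mapP[a aT ->] /mapP[b bT ->]]; first by rewrite rK.
  rewrite !rK //; move: (T1 _ aT) (T1 _ bT) (T2 _ aT) (T2 _ bT); rewrite /=; clear.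
  by move=> *; split; lia.
Qed.

Lemma colorable_reverse_complement (Q Q' : config -> Prop) :
  (forall T T' f, anti_emb T T' f -> Q T -> Q' T') ->
  (forall T T' f, anti_emb T T' f -> Q' T -> Q T') ->
  colorable Q -> colorable Q'.
Proof.
move=> QQ' Q'Q [m [R [m0 RP Rcol]]].
have /choice[R' R'P] : forall i, exists R' : config, i < m ->
    [/\ generic R', R' <> [::], ~ Q' R' & exists f, anti_emb (R i) R' f].
  move=> i; have [im|] := boolP (i < m); last by exists [::].
  have [gR R0 nQ] := RP i im.
  have [R' [f [g [gR' af ag _ fR]]]] := exists_reverse_complement gR.
  exists R' => _; split=> //; [|by move/(Q'Q _ _ _ ag)|by exists f].
  by rewrite -fR; case: (R i) R0.
exists m, R'; split=> // [i im|T gT nQ']; first by case: (R'P i im).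
have [T' [f [g [gT' af ag fK _]]]] := exists_reverse_complement gT.
have [c [cm cP]] := Rcol T' gT' (fun h => nQ' (QQ' _ _ _ ag h)).
exists (c \o f); split=> [p|i im [h eh]]; first exact: cm.
have [_ _ _ [k ak]] := R'P i im; apply: (cP i im).
exists (f \o (h \o k)).
apply: anti_comp (anti_emb_comp ak eh) _.
split=> [p|p q]; last by rewrite !mem_filter => /andP[_ pT] /andP[_ qT]; apply: (proj2 af).
by rewrite !mem_filter => /andP[/= -> pT]; apply: (proj1 af).
Qed.

Lemma splittable_one_dsum (t : permutation) :
  ~ decomposable t -> 2 < size t -> splittable (Av (dsum unit_perm t)).
Proof.
move=> nt t2; apply: splittable_colorable.
have [m [R [m0 RP Rcol]]] := colorable_one_plus
  (generic_graph (permutation_uniq t)) (indecomposable_graph nt) (large_graph t2).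
have eqQ T : contains_one_plus (graph t) T <-> emb_into (graph (dsum unit_perm t)) T.
  rewrite -contains_sum_dsum; split=> [[o oT [f ef fo]]|[f [g [ef eg fg]]]].
    exists (fun=> o), f; split=> // [|p q _ /fo //].
    split=> // p q; rewrite !graph_unit_perm => /eqP-> /eqP->.
    by rewrite !ltnn.
  exists (f (0, 1)); first by apply: (proj1 ef); rewrite graph_unit_perm.
  by exists g => // p pt; apply: fg; rewrite ?graph_unit_perm.
exists m, R; split=> // [i /RP[gR R0 nQ]|T gT nQ]; first by split=> //; rewrite -eqQ.
by apply: Rcol => //; rewrite eqQ.
Qed.

(** [S] is the reverse-complement of [s]; the half-turn exchanges s (+) 1 with 1 (+) S. *)
Lemma splittable_dsum_one (s : permutation) :
  ~ decomposable s -> 2 < size s -> splittable (Av (dsum s unit_perm)).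
Proof.
move=> ns s2; apply: splittable_colorable.
have gs := generic_graph (permutation_uniq s).
have [S [f [g [gS af ag fK fS]]]] := exists_reverse_complement gs.
have gK p : p \in S -> f (g p) = p by rewrite -fS => /mapP[q qs ->]; rewrite fK.
have iS : indecomposable S.
  move=> D sep; case: (indecomposable_graph ns (D := fun p => ~~ D (f p))).
  - move=> p q ps qs nDp /negPn Dq.
    have := sep _ _ (proj1 af _ qs) (proj1 af _ ps) Dq nDp.
    by rewrite /ll; have [-> ->] := proj2 af _ _ qs ps.
  - by move=> h; right=> p pS; rewrite -(gK _ pS); apply: h; apply: (proj1 ag).
  - move=> h; left=> p pS; rewrite -(gK _ pS).
    by apply/negPn; apply: h; apply: (proj1 ag).
have lS : large S.
  move=> a b; have [c [cs ca cb]] := large_graph s2 (g a) (g b).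
  exists (f c); split; first exact: (proj1 af).
    by apply: contraNneq ca => <-; rewrite fK.
  by apply: contraNneq cb => <-; rewrite fK.
apply: colorable_reverse_complement (colorable_one_plus gS iS lS).
- move=> T T' k ak [o oT [h eh ho]]; apply/contains_sum_dsum.
  exists (k \o (h \o f)), (fun=> k o); split.
  + exact: anti_comp (anti_emb_comp af eh) ak.
  + split=> [p _|p q]; first exact: (proj1 ak).
    by rewrite !graph_unit_perm => /eqP-> /eqP->; rewrite !ltnn.
  move=> p q /(proj1 af) pS _; have := ho _ pS.
  by rewrite /ll /=; have [-> ->] := proj2 ak _ _ (proj1 eh _ pS) oT.
move=> T T' k ak /contains_sum_dsum[h [j [eh ej hj]]].
have one1 : (0, 1) \in graph unit_perm by rewrite graph_unit_perm.
exists (k (j (0, 1))); first by apply/(proj1 ak)/(proj1 ej).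
exists (k \o (h \o g)); first exact: anti_comp (anti_emb_comp ag eh) ak.
move=> p /(proj1 ag) ps; have := hj _ _ ps one1.
rewrite /ll /=.
by have [-> ->] := proj2 ak _ _ (proj1 ej _ one1) (proj1 eh _ ps).
Qed.

(** * Small summands and the final case analysis *)

Lemma small_indecomposable (s : permutation) : ~ decomposable s -> size s <= 2 ->
  pseq s = [:: 1] \/ pseq s = [:: 2; 1].
Proof.
move=> ns; case: s ns => -[|a [|b [|//]]] sP //= ns _.
  by left; have := size1_unit_perm (s := Permutation sP) erefl => /(congr1 val).
right; case/andP: (sP) => _ sP'.
have /= ma := perm_mem sP' a; have /= mb := perm_mem sP' b; have /= u := perm_uniq sP'.
have [ab|ab] : ([:: a; b] = [:: 1; 2] \/ [:: a; b] = [:: 2; 1]).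
  by move: ma mb u; rewrite !inE !eqxx ?orbT /= => /esym/orP[]/eqP-> /esym/orP[]/eqP->; auto.
- by case: ns; exists unit_perm, unit_perm; apply/val_inj => /=; rewrite ab.
by rewrite ab.
Qed.

Unset Implicit Arguments.
Set Strict Implicit.
Set Printing Implicit Defensive.

Theorem theorem3p1 (pi : permutation) :
  decomposable pi ->
  pseq pi <> [:: 1; 2] ->
  pseq pi <> [:: 2; 1; 3] ->
  pseq pi <> [:: 1; 3; 2] ->
  splittable (Av pi).
Proof.
move=> [s [t ->]] n12 n213 n132.
have [s1|s1] := leqP (size s) 1.
  have es : s = unit_perm.
    by apply: size1_unit_perm; apply/eqP; rewrite eqn_leq s1 size_permutation.
  rewrite es in n12 n213 n132 *.
  have [[a [b ->]]|nt] := EM (decomposable t); first exact: splittable_dsum3r.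
  have [t2|] := leqP (size t) 2; last exact: splittable_one_dsum.
  (* Here [t] is 1 or 21, which gives the excluded sums 12 and 132. *)
  by case: (small_indecomposable nt t2) => e; [case: n12|case: n132]; rewrite /= e.
have [t1|t1] := leqP (size t) 1; last exact: splittable_dsum_large.
have et : t = unit_perm.
  by apply: size1_unit_perm; apply/eqP; rewrite eqn_leq t1 size_permutation.
rewrite et in n12 n213 n132 *.
have [[a [b ->]]|ns] := EM (decomposable s); first exact: splittable_dsum3l.
have [s2|] := leqP (size s) 2; last exact: splittable_dsum_one.
by case: (small_indecomposable ns s2) => e; [case: n12|case: n213]; rewrite /= e.
Qed.
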